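(* Let $G$ be a graph of type $\mathscr{G}_{\mathrm I}(A,B)$. If $G$ has at least one cut vertex, then $G_A$ is an $a$-tree, an $a$-cycle, or the complete graph $K_{p+1}^{a,b}$, and for some $a,b,c,d\in\mathbb{Z}^+$ one of the following holds: (i) there exists $i\in A\cup\{0\}$ such that $G[\{i\}\cup B]$ is a $c$-tree, a $c$-cycle, or $K_{q+1}^{c,d}$ with root $i$, and no other vertex of $A\cup\{0\}$ is adjacent to a vertex of $B$; (ii) there exist $i_1,\dots,i_n\in A\cup\{0\}$ with $n>1$ such that $G[\{i_1,\dots,i_n\}\cup B]$ is a forest of $c$-trees, and no other vertex of $A\cup\{0\}$ is adjacent to a vertex of $B$.
   Context: A graph is a finite, connected, undirected, loopless multigraph with a root, viewed as a simple graph with edge-weight function $wt$ counting parallel edges. For $U\subseteq V$, $i\in U$, $d_U(i)=\sum_{j\notin U}wt(\{i,j\})$; a parking function of a rooted graph is an assignment $(b_i)$ of non-negative integers to the non-root vertices such that every non-empty set $U$ of non-root vertices contains $i$ with $b_i<d_U(i)$; $\mathcal{PF}(G)$ is their set. $G$ has type $\mathscr{G}_{\mathrm I}(A,B)$ if $V(G)=\{0\}\cup A\cup B$ with root $0$, $A=\{1,\dots,p\}$, $B=\{p+1,\dots,p+q\}$, $p,q\in\mathbb{Z}^+$; $G_A=G[\{0\}\cup A]$ is connected; and $\mathcal{PF}(G)$ is invariant under $\mathfrak{S}_p\times\mathfrak{S}_q$ acting by permuting $(b_1,\dots,b_p)$ and $(b_{p+1},\dots,b_{p+q})$ separately. $G[S]$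 is the induced subgraph on $S$ with inherited weights. A cut vertex is a vertex whose deletion disconnects $G$. An $x$-tree (resp. $x$-cycle) is a tree (resp. cycle) with all edge weights $x$; a forest of $c$-trees is a forest with all edge weights $c$. $K_{n+1}^{x,y}$ is the complete graph on a root and $n$ other vertices with weight $x$ on edges at the root and $y$ on all other edges; ''with root $i$'' means $i$ plays the role of the root.
   Formalization: In (ii) edges joining two of the i_j are disregarded; the other edges of G[{i_1,…,i_n}∪B] form a forest of c-trees, each containing at most one i_j. As printed (ii) fails: p=1, q=2, edges 01, 02, 13 of weights 1, 2, 2. *)

(* Defs.v *)
From mathcomp Require Import all_boot all_fingroup.

Set Implicit Arguments.
Unset Strict Implicit.
Unset Printing Implicit Defensive.

Section WeightedGraphs.
Variable V : finType.

(* A loopless undirected multigraph whose vertex set is a subset of the finite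
   type V; [wt i j] is the number of parallel edges between i and j.
   Connectedness is a separate predicate, because subgraphs need not be
   connected. *)
Record wgraph := WGraph {
  verts : {set V};
  wt : V -> V -> nat;
  wt_sym : forall i j, wt i j = wt j i;
  wt_loopless : forall i, wt i i = 0;
  wt_verts : forall i j, 0 < wt i j -> i \in verts
}.

Implicit Types (G : wgraph) (S U : {set V}) (r : V) (b : V -> nat).

Definition adj G : rel V := fun i j => 0 < wt G i j.

Definition connected G : bool :=
  [forall i in verts G, forall j in verts G, connect (adj G) i j].

Definition induced_wt G S i j :=
  if (i \in S) && (j \in S) then wt G i j else 0.

Lemma induced_wt_sym G S i j : induced_wt G S i j = induced_wt G S j i.
Proof. by rewrite /induced_wt andbC wt_sym. Qed.

Lemma induced_wt_loopless G S i : induced_wt G S i i = 0.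
Proof. by rewrite /induced_wt wt_loopless if_same. Qed.

Lemma induced_wt_verts G S i j :
  0 < induced_wt G S i j -> i \in verts G :&: S.
Proof.
by rewrite /induced_wt inE; case: andP => // -[-> _] /wt_verts ->.
Qed.

Definition induced G S : wgraph :=
  WGraph (induced_wt_sym G S) (induced_wt_loopless G S)
         (@induced_wt_verts G S).

(* [del_inner G S] has the vertices of G, and the edges of G that do not join
   two vertices of S. *)
Definition del_inner_wt G S i j :=
  if (i \in S) && (j \in S) then 0 else wt G i j.

Lemma del_inner_wt_sym G S i j : del_inner_wt G S i j = del_inner_wt G S j i.
Proof. by rewrite /del_inner_wt andbC wt_sym. Qed.

Lemma del_inner_wt_loopless G S i : del_inner_wt G S i i = 0.
Proof. by rewrite /del_inner_wt wt_loopless if_same. Qed.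

Lemma del_inner_wt_verts G S i j : 0 < del_inner_wt G S i j -> i \in verts G.
Proof. by rewrite /del_inner_wt; case: ifP => // _ /wt_verts. Qed.

Definition del_inner G S : wgraph :=
  WGraph (del_inner_wt_sym G S) (del_inner_wt_loopless G S)
         (@del_inner_wt_verts G S).

Definition cut_vertex G v : Prop :=
  v \in verts G /\ ~~ connected (induced G (~: [set v])).

Definition acyclic G : Prop := forall s : seq V, ucycle (adj G) s -> size s <= 2.

Definition all_weights x G : Prop := forall i j, adj G i j -> wt G i j = x.

Definition x_forest x G : Prop := acyclic G /\ all_weights x G.

Definition x_tree x G : Prop := connected G /\ x_forest x G.

(* A cycle has at least three vertices: a pair of parallel edges is an edge of
   weight 2. *)
Definition x_cycle x G : Prop :=
  exists s : seq V,
    [/\ 2 < size s, uniq s, verts G = [set i in s],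
        {in s &, forall i j, adj G i j = (j == next s i) || (i == next s j)}
      & all_weights x G].

(* G is K_{n+1}^{x,y} with root r. *)
Definition complete_xy n x y r G : Prop :=
  [/\ r \in verts G, #|verts G| = n.+1
    & {in verts G &, forall i j, i != j ->
         wt G i j = if (i == r) || (j == r) then x else y}].

Definition outdeg G U i : nat := \sum_(j | j \notin U) wt G i j.

(* Only the values of b at the non-root vertices of G matter. *)
Definition parking_function G r b : Prop :=
  forall U, U \subset verts G :\ r -> U != set0 ->
    exists2 i, i \in U & b i < outdeg G U i.

(* The edges of G from S to B and inside B form a forest of c-trees, and these
   trees attach to S at single vertices: no tree contains two vertices of S.

   The edges of G[S :|: B] joining two vertices of S are left out, since their
   weights and the cycles they form do not depend on B. For example, the path
   2 - 0 - 1 - 3 with root 0, A = {1}, B = {2, 3}, whose edges 02, 01, 13 have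
   weights 2, 1, 2, has an invariant set of parking functions and is the union
   of a 1-tree on {0, 1} and 2-trees at 0 and 1, but the path itself does not
   have constant weight. *)
Definition attached_forest c S B G : Prop :=
  let H := del_inner (induced G (S :|: B)) S in
  x_forest c H /\ {in S &, forall i j, i != j -> ~~ connect (adj H) i j}.

End WeightedGraphs.

Definition partA p q := [set i : 'I_(p + q).+1 | 0 < i <= p].
Definition partB p q := [set i : 'I_(p + q).+1 | p < i].

Definition rootA p q : {set 'I_(p + q).+1} := ord0 |: partA p q.

(* S_p x S_q is the group of the products s * t, with s fixing everything
   outside A and t fixing everything outside B. *)
Definition PF_invariant p q (G : wgraph 'I_(p + q).+1) : Prop :=
  forall (s t : {perm 'I_(p + q).+1}) (b : 'I_(p + q).+1 -> nat),
    perm_on (partA p q) s -> perm_on (partB p q) t ->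
    parking_function G ord0 b ->
    parking_function G ord0 (fun i => b ((s * t)%g i)).

Definition type_I p q (G : wgraph 'I_(p + q).+1) : Prop :=
  [/\ 0 < p /\ 0 < q, verts G = setT, connected G,
      connected (induced G (rootA p q)) & PF_invariant G].

(* Main.v *)
Require Import Defs.
From mathcomp Require Import all_boot all_fingroup zify.

Set Implicit Arguments.
Unset Strict Implicit.
Unset Printing Implicit Defensive.

(* A maximal parking function, shifted by one, records for each vertex the
   weight of the edges to the vertices burnt before it in Dhar's algorithm
   (predicate [burn]). All these functions have the same sum, so invariance of
   the parking functions under a transposition passes to them, and then, by
   fixing the values on the vertices burnt first or last, to the graphs obtained
   by contracting a burnt set and deleting a final one.

   Contracting an edge at the root then shows by induction that a graph
   with fully invariant parking functions is a tree, a cycle or complete. This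
   applies to G_A and to the graph G/A0 obtained by contracting A0 = {0} + A.

   Suppose that B is attached to at least two vertices of A0 but not as a
   forest. If G/A0 is a tree, burning a vertex of B with two neighbours in A0 as
   early as possible gives it a value that only a vertex with two neighbours in
   A0 can take, so that all of B has two neighbours in A0; otherwise B is
   connected. In both cases a cut vertex must lie in A0 and make G_A a tree.
   Burning a part of B early gives some vertex of A a value above a, while some
   vertex of A across the cut hangs on a single edge of weight a: exchanging
   these two values is impossible. *)

(** * Burning orders *)

Section Burning.
Variables (V : finType) (G : wgraph V).
Implicit Types (x y z u v : V) (D W I X U Z P : {set V}) (g h f : V -> nat).

Definition wsum x D := \sum_(j in D) wt G x j.

(** [D] is the set already burnt and [W] the set still to burn. Shrinking [W] expresses deletion of
    vertices, and enlarging [D] expresses contraction to the root. The order itself is forgotten: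
    only the values of [g] on [W] are kept. *)
Inductive burn g : {set V} -> {set V} -> Prop :=
| burn0 D : burn g D set0
| burnS x D W : x \in W -> x \notin D -> 0 < wsum x D -> g x = wsum x D ->
    burn g (x |: D) (W :\ x) -> burn g D W.

Lemma disjoint_setU1 x D W :
  [disjoint x |: D & W] = (x \notin W) && [disjoint D & W].
Proof. by rewrite !disjoints_subset subUset sub1set inE. Qed.

Lemma disjoint_setDr I X : [disjoint I & X :\: I].
Proof. by rewrite disjoints_subset setCD subsetUr. Qed.

Lemma wsumU1 x y D : x \notin D -> wsum y (x |: D) = wt G y x + wsum y D.
Proof. exact: big_setU1. Qed.

Lemma wsumD1 x y D : x \in D -> wsum y D = wt G y x + wsum y (D :\ x).
Proof. exact: big_setD1. Qed.

Lemma wsum1 x y : wsum y [set x] = wt G y x.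
Proof. exact: big_set1. Qed.

Lemma wsumU x D W : [disjoint D & W] -> wsum x (D :|: W) = wsum x D + wsum x W.
Proof. by move=> dDW; rewrite /wsum -bigU //; apply: eq_bigl => j; rewrite inE. Qed.

Lemma wsum_sub x D W : D \subset W -> wsum x D <= wsum x W.
Proof.
move=> /setIidPr DW; rewrite /wsum [leqRHS](big_setID D) /= DW; exact: leq_addr.
Qed.

Lemma wsum_ge x y D : y \in D -> wt G x y <= wsum x D.
Proof. by move=> yD; rewrite (wsumD1 _ yD) leq_addr. Qed.

Lemma wsum_gt0P x D : reflect (exists2 y, y \in D & 0 < wt G x y) (0 < wsum x D).
Proof.
apply: (iffP idP) => [|[y yD xy]]; last exact: leq_trans xy (wsum_ge _ yD).
rewrite lt0n sum_nat_eq0 negb_forall => /existsP[y].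
by rewrite negb_imply -lt0n => /andP[]; exists y.
Qed.

Lemma wsum_eq0P x D : reflect {in D, forall y, wt G x y = 0} (wsum x D == 0).
Proof.
rewrite /wsum sum_nat_eq0; apply: (iffP forall_inP) => H y /H; last by move->.
by move/eqP.
Qed.

Lemma wsum_le_support u X D : (forall y, y \in X -> 0 < wt G u y -> y \in D) ->
  wsum u X <= wsum u D.
Proof.
move=> XD; rewrite /wsum (big_setID D) /= [X in _ + X]big1 ?addn0.
  exact: wsum_sub (subsetIr _ _).
move=> y /setDP[yX yD]; apply/eqP; rewrite -leqn0 leqNgt; apply: contra yD.
exact: XD.
Qed.

Lemma burn_ext g h D W : {in W, g =1 h} -> burn g D W -> burn h D W.
Proof.
move=> gh b; elim: b gh => [{}D|x {}D {}W xW xD x0 gx _ IH] gh; first exact: burn0.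
apply: (burnS xW xD x0); first by rewrite -(gh _ xW).
by apply: IH => y /setD1P[_ yW]; apply: gh.
Qed.

Lemma burn_disjoint g D W : burn g D W -> [disjoint D & W].
Proof.
elim=> [{}D|x {}D {}W xW xD _ _ _ IH]; first by rewrite -setI_eq0 setI0.
rewrite disjoints_subset; apply/subsetP=> y yD; rewrite !inE.
have := disjointFr IH (x := y); rewrite !inE yD orbT => /(_ isT).
by case: eqP => [yx|_ /= ->//]; rewrite -yx yD in xD.
Qed.

Lemma burn_pos g D W x : burn g D W -> x \in W -> 0 < g x.
Proof.
elim=> [{}D|y {}D {}W yW yD y0 gy _ IH]; first by rewrite inE.
by have [->|xy xW] := eqVneq x y; [rewrite gy | apply: IH; rewrite !inE xy].
Qed.

Lemma burn_lower g D W x : burn g D W -> x \in W -> wsum x D <= g x.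
Proof.
elim=> [{}D|y {}D {}W yW yD _ gy _ IH]; first by rewrite inE.
have [->|xy xW] := eqVneq x y; first by rewrite gy.
apply: leq_trans (IH _); last by rewrite !inE xy.
exact: wsum_sub (subsetUr _ _).
Qed.

Lemma setU1D1 x D W : x \in W -> (x |: D) :|: (W :\ x) = D :|: W.
Proof.
move=> xW; apply/setP=> y; rewrite !inE.
by case: eqP => [->|]; rewrite ?xW ?orbT.
Qed.

Lemma burn_cat g D W X :
  burn g D W -> burn g (D :|: W) X -> burn g D (W :|: X).
Proof.
elim=> [{}D|x {}D {}W xW xD x0 gx bW IH bX]; first by rewrite setU0 set0U.
apply: (burnS _ xD x0 gx); first by rewrite inE xW.
have -> : (W :|: X) :\ x = (W :\ x) :|: X.
  apply/setP=> y; rewrite !inE; case: eqP => [->|//] /=.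
  by rewrite (disjointFr (burn_disjoint bX)) // !inE xW orbT.
by apply: IH; rewrite setU1D1.
Qed.

Lemma burn1 g D x : x \notin D -> 0 < wsum x D -> g x = wsum x D ->
  burn g D [set x].
Proof.
by move=> xD x0 gx; apply: (burnS (set11 x)) => //; rewrite setDv; apply: burn0.
Qed.

Lemma burn_base g D D' W : [disjoint D' & W] ->
  {in W, forall x, wsum x D = wsum x D'} -> burn g D W -> burn g D' W.
Proof.
move=> dW eqD b; elim: b D' dW eqD => [{}D|x {}D {}W xW xD x0 gx _ IH] D' dW eqD.
  exact: burn0.
have xD' : x \notin D' by rewrite (disjointFl dW).
apply: (burnS xW xD'); rewrite -?eqD //; apply: IH => [|y /setD1P[_ yW]].
  rewrite disjoints_subset; apply/subsetP=> y; rewrite !inE negb_and negbK.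
  by case: eqP => //= _ yD'; rewrite (disjointFr dW).
by rewrite !wsumU1 // eqD.
Qed.

Lemma setD1C W x y : W :\ x :\ y = W :\ y :\ x.
Proof. by apply/setP=> z; rewrite !inE andbCA. Qed.

(** The value of [x] is its whole degree inside [D] and [W], so no vertex that burns after [x] is
    adjacent to it, and skipping [x] changes no value. *)
Lemma burn_delete1 g D W x : x \in W -> g x = wsum x (D :|: (W :\ x)) ->
  burn g D W -> burn g D (W :\ x).
Proof.
move=> + + b; elim: b => {D W} [D|y D W yW yD y0 gy bW IH] xW gx.
  by rewrite inE in xW.
have dDW : [disjoint D & W] := burn_disjoint (burnS yW yD y0 gy bW).
have [xy|xy] := eqVneq x y.
  have dDx : [disjoint D & W :\ x] by apply: disjointWr dDW; apply: subD1set.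
  rewrite -xy in yD gy bW *; apply: (burn_base _ _ bW) => [//|z /setD1P[zx zW]].
  rewrite wsumU1 //; have /eqP := gx; rewrite gy wsumU //.
  rewrite -[eqbLHS]addn0 eqn_add2l eq_sym => /wsum_eq0P /(_ z).
  by rewrite !inE zx zW wt_sym => ->.
apply: (burnS (x := y)) => //; first by rewrite !inE eq_sym xy.
rewrite setD1C; apply: IH; first by rewrite !inE xy.
rewrite gx setD1C setU1D1 //.
by rewrite !inE eq_sym xy.
Qed.

(** [X] is peeled off in the reverse of the order in which [h] burns it, so that each removed vertex
    has full weight to everything left. *)
Lemma burn_delete g h D W X : burn h (D :|: W) X -> {in X, g =1 h} ->
  burn g D (W :|: X) -> burn g D W.
Proof.
move DWE: (D :|: W) => DW' b; elim: b D W DWE =>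
  {DW' X} [DW|x DW X xX xD x0 hx bX IH] D W DWE gh bg.
  by rewrite setU0 in bg.
have xW : x \notin W by apply: contra xD; rewrite -DWE inE => ->; rewrite orbT.
have {}IH : burn g D (x |: W).
  apply: (IH D (x |: W)) => [|y /setD1P[_]|]; [by rewrite setUCA DWE | exact: gh |].
  by rewrite setU1D1.
rewrite -(setU1K xW); apply: burn_delete1 IH; first exact: setU11.
by rewrite setU1K // gh // hx DWE.
Qed.

(** The value of [x] is already reached on [D], so what burns before [x] has no edge to it. Hence
    [x] can be moved to the front without changing any value. *)
Lemma burn_contract1 g D W x : x \in W -> g x = wsum x D ->
  burn g D W -> burn g (x |: D) (W :\ x).
Proof.
move=> + + b; elim: b => {D W} [D|y D W yW yD y0 gy bW IH] xW gx.
  by rewrite inE in xW.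
have [->//|xy] := eqVneq x y.
have xWy : x \in W :\ y by rewrite !inE xy.
have gle := burn_lower bW xWy; have w0 : wt G x y = 0.
  by move: gle; rewrite wsumU1 // gx; lia.
have {}IH := IH xWy; rewrite wsumU1 // w0 in IH.
have xD : x \notin D.
  by have := disjointFl (burn_disjoint bW) xWy; rewrite !inE => /negbT/norP[].
have E : wsum y (x |: D) = wsum y D by rewrite wsumU1 // wt_sym w0.
have yx : y != x by rewrite eq_sym.
apply: (burnS (x := y)); rewrite ?inE ?E ?negb_or ?yx //.
by rewrite setUCA setD1C; apply: IH.
Qed.

Lemma burn_contract g f D I W : burn f D I -> {in I, g =1 f} ->
  [disjoint I & W] -> burn g D (I :|: W) -> burn g (D :|: I) W.
Proof.
move=> b; elim: b W => {D I} [D|x D I xI xD x0 fx bI IH] W gf dI bg.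
  by rewrite set0U setU0 in bg *.
rewrite -(setU1D1 D xI); apply: IH => [y /setD1P[_ /gf]//| |].
  exact: disjointWl (subD1set _ _) dI.
have -> : I :\ x :|: W = (I :|: W) :\ x.
  by apply/setP=> y; rewrite !inE; case: eqP => [->|//]; rewrite (disjointFr dI).
by apply: burn_contract1 bg; rewrite ?inE ?xI // gf.
Qed.

Lemma burn_add g D W X : [disjoint X & D :|: W] -> burn g D W ->
  burn (fun x => g x + wsum x X) (D :|: X) W.
Proof.
move=> + b; elim: b => {D W} [D|x D W xW xD x0 gx bW IH] dX; first exact: burn0.
have xX : x \notin X by rewrite (disjointFl dX) // inE xW orbT.
have dXD : [disjoint D & X].
  by rewrite disjoint_sym; apply: disjointWr dX; apply: subsetUl.
apply: (burnS (x := x)); rewrite ?inE ?negb_or ?xD ?wsumU ?gx ?addn_gt0 ?x0 //.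
by rewrite setUA; apply: IH; rewrite setU1D1.
Qed.

Lemma burn_upper g D W x : burn g D W -> x \in W -> g x <= wsum x (D :|: W).
Proof.
elim=> {D W} [D|y D W yW yD _ gy _ IH]; first by rewrite inE.
have [->|xy xW] := eqVneq x y; first by rewrite gy wsum_sub // subsetUl.
by rewrite -(setU1D1 _ yW); apply: IH; rewrite !inE xy.
Qed.

(* The first vertex of U to burn can only be u. *)
Lemma burn_gate g D W U u : burn g D W -> U \subset W -> u \in U ->
  {in U, forall x, x != u -> wsum x ((D :|: W) :\: U) = 0} ->
  g u <= wsum u ((D :|: W) :\: U).
Proof.
move=> b; elim: b U => {D W} [D|x D W xW xD x0 gx bW IH] U UW uU Ugate.
  by have := subsetP UW _ uU; rewrite inE.
have DU : D \subset (D :|: W) :\: U.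
  apply/subsetP=> y yD; rewrite !inE yD andbT; apply/negP=> /(subsetP UW) yW.
  by have := disjointFr (burn_disjoint (burnS xW xD x0 gx bW)) yD; rewrite yW.
have [xU|xU] := boolP (x \in U).
  have [<-|xu] := eqVneq x u; first by rewrite gx wsum_sub.
  by have := leq_trans x0 (wsum_sub x DU); rewrite Ugate.
rewrite -(setU1D1 _ xW); apply: IH => // [|y yU yu]; last by rewrite setU1D1 ?Ugate.
by rewrite subsetD1 UW.
Qed.

(** [u] is the last vertex of [Z] to burn, and [I] is what burns before it. *)
Lemma burn_last g D W Z : burn g D W -> ~~ [disjoint Z & W] ->
  exists u I, [/\ u \in Z :&: W, burn g D I, g u = wsum u (D :|: I),
    0 < wsum u (D :|: I) & Z :&: (D :|: W) \subset u |: (D :|: I)].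
Proof.
elim=> {D W} [D|x D W xW xD x0 gx bW IH]; first by rewrite -setI_eq0 setI0 eqxx.
have [dZ|/IH] := boolP [disjoint Z & W :\ x]; last first.
  case=> u [I [uZ bI gu u0 Zu] _]; exists u, (x |: I).
  have xI : x \notin I by rewrite (disjointFr (burn_disjoint bI)) ?setU11.
  rewrite setUCA setUA; rewrite setU1D1 // in Zu.
  split=> //; first by move: uZ; rewrite !inE => /and3P[->].
  by apply: (burnS (x := x)) => //; rewrite ?setU11 // setU1K.
case/pred0Pn=> y /= /andP[yZ yW].
have yx : y = x.
  by apply/eqP; apply: contraFT (disjointFr dZ yZ); rewrite !inE yW andbT.
subst y; exists x, set0; rewrite setU0; split=> //; rewrite ?inE ?yZ //.
  exact: burn0.
apply/subsetP=> y; rewrite !inE => /andP[{}yZ /orP[->|]]; first by rewrite orbT.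
by move=> {}yW; have := disjointFr dZ yZ; rewrite !inE yW andbT => /negbFE ->.
Qed.

(** The fire is stopped as soon as it meets [Z]; if [D] already meets [Z], then [I] is taken
    empty. *)
Lemma burn_first_hit g D W Z : burn g D W -> ~~ [disjoint Z & D :|: W] ->
  #|Z :&: D| <= 1 ->
  exists i I, [/\ I \subset W, burn g D I & Z :&: (D :|: I) = [set i]].
Proof.
move=> b nZ; rewrite leq_eqVlt => /orP[/cards1P[i Zi]|].
  by exists i, set0; rewrite sub0set setU0; split=> //; apply: burn0.
rewrite ltnS leqn0 cards_eq0 setI_eq0 => ZD.
elim: b nZ ZD => {D W} [D|x D W xW xD x0 gx bW IH] nZ ZD.
  by rewrite setU0 ZD in nZ.
have [xZ|xZ] := boolP (x \in Z).
  exists x, [set x]; split; rewrite ?sub1set //; first exact: burn1.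
  apply/setP=> y; rewrite !inE; have [->|_] := eqVneq y x; first by rewrite xZ orbT.
  by rewrite orbF; apply/andP=> -[yZ]; rewrite (disjointFr ZD).
rewrite -(setU1D1 _ xW) in nZ; case/IH: nZ => [|i [I [IW bI Zi]]].
  by rewrite disjoint_sym disjoint_setU1 xZ disjoint_sym.
exists i, (x |: I); split; last by rewrite setUCA setUA.
  by rewrite subUset sub1set xW (subset_trans IW (subD1set _ _)).
apply: (burnS (x := x)) => //; rewrite ?setU11 // setU1K //.
by apply/negP=> /(subsetP IW); rewrite !inE eqxx.
Qed.

(** Connectivity of the graph on [W] with [D] contracted to a root, in the form of the parking
    condition: no non-empty part of [W] is cut off from the rest. *)
Definition conn D W := forall U, U \subset W -> U != set0 ->
  exists2 x, x \in U & 0 < wsum x ((D :|: W) :\: U).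

Lemma conn_sub D D' W W' : D' :|: W' = D :|: W -> W' \subset W ->
  conn D W -> conn D' W'.
Proof. by move=> e WW c U UW U0; rewrite e; apply: c => //; apply: subset_trans WW. Qed.

Lemma conn_next D W : [disjoint D & W] -> conn D W -> W != set0 ->
  exists2 x, x \in W & 0 < wsum x D.
Proof.
move=> dW c /(c W (subxx _))[x xW]; rewrite setDUl setDv setU0.
by rewrite (setDidPl dW); exists x.
Qed.

Lemma conn_burn D W : [disjoint D & W] -> conn D W -> exists g, burn g D W.
Proof.
have [n] := ubnP #|W|; elim: n D W => // n IH D W; rewrite ltnS => Wn dW c.
have [->|W0] := eqVneq W set0; first by exists (fun=> 0); apply: burn0.
have [x xW x0] := conn_next dW c W0.
have xD : x \notin D by rewrite (disjointFl dW).
have [|||g bg] := IH (x |: D) (W :\ x).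
- by rewrite (cardsD1 x) xW in Wn.
- rewrite disjoint_setU1 !inE eqxx /=.
  exact: disjointWr (subD1set _ _) dW.
- by apply: conn_sub c; rewrite ?setU1D1 ?subD1set.
exists (fun y => if y == x then wsum x D else g y).
apply: (burnS (x := x)) => //; first by rewrite eqxx.
by apply: burn_ext bg => y /setD1P[/negPf->].
Qed.

Lemma burn_extend f D I W : burn f D I -> [disjoint D :|: I & W] ->
  conn (D :|: I) W -> exists2 g, burn g D (I :|: W) & {in I, g =1 f}.
Proof.
move=> bI dW /(conn_burn dW)[h bh].
have IW x : x \in W -> x \in I = false.
  by move/(disjointFl dW); rewrite inE => /norP[_ /negPf].
exists (fun x => if x \in I then f x else h x) => [|x ->//].
apply: burn_cat; first by apply: burn_ext bI => x ->.
by apply: burn_ext bh => x /IW ->.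
Qed.

(** Transpositions generate the permutations of [P], so this is invariance under the symmetric group
    of [P]. *)
Definition swap_inv P D W := forall g u v, u \in P -> v \in P ->
  burn g D W -> burn (fun x => g (tperm u v x)) D W.

(** A function on [W] is completed by [f], burnt before, and by [h], burnt after. The transposition
    moves neither part, so after the swap [X] can be deleted and [I] contracted again. *)
Lemma swap_inv_slice P D I W X f h : swap_inv P D (I :|: W :|: X) -> P \subset W ->
  burn f D I -> [disjoint I & W] -> burn h (D :|: I :|: W) X ->
  swap_inv P (D :|: I) W.
Proof.
move=> inv PW bI dIW bX g u v uP vP bg.
have XN x : x \in X -> (x \in I = false) * (x \in W = false).
  move/(disjointFl (burn_disjoint bX)); rewrite !inE.
  by move=> /norP[/norP[_ /negPf->] /negPf->].
have uW := subsetP PW _ uP; have vW := subsetP PW _ vP.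
have NW x : x \notin W -> tperm u v x = x.
  by move=> xW; apply: tpermD; apply: contraNneq xW => <-.
have tW x : x \in W -> tperm u v x \in W by case: tpermP => // ->.
pose k x := if x \in I then f x else if x \in W then g x else h x.
have bk : burn k D (I :|: W :|: X).
  apply: burn_cat; [apply: burn_cat|rewrite setUA].
  - by apply: burn_ext bI => x xI; rewrite /k xI.
  - by apply: burn_ext bg => x xW; rewrite /k xW (disjointFl dIW).
  - by apply: burn_ext bX => x xX; rewrite /k !XN.
have {}bk := inv _ _ _ uP vP bk; rewrite -setUA in bX.
have {}bk := burn_delete bX _ bk.
apply: burn_ext (burn_contract bI _ dIW (bk _)) => [x xW|x xI|x xX].
- by rewrite /k tW // (disjointFl dIW) ?tW.
- by rewrite NW ?(disjointFr dIW) // /k xI.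
- by rewrite NW ?XN // /k !XN.
Qed.

End Burning.

(** * Graphs with invariant parking functions *)

Section NeighborhoodOfRoot.
Variables (V : finType) (G : wgraph V).
Implicit Types (x y z u v : V) (D W I X U Z P : {set V}) (g h f : V -> nat).
Implicit Types (a b : nat) (s : seq V).

Local Notation wt := (wt G).
Local Notation wsum := (wsum G).
Local Notation burn := (burn G).

Lemma burnP g D W : burn g D W -> W != set0 -> exists x,
  [/\ x \in W, x \notin D, 0 < wsum x D, g x = wsum x D & burn g (x |: D) (W :\ x)].
Proof. by case=> [? /eqP//|x {}D {}W xW xD x0 gx b _]; exists x. Qed.

Lemma swap_inv_sub P P' D W : P' \subset P -> swap_inv G P D W -> swap_inv G P' D W.
Proof. by move=> /subsetP PP inv g u v /PP uP /PP vP; apply: inv. Qed.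

Definition invariant_at D W :=
  [/\ [disjoint D & W], conn G D W & swap_inv G W D W].

Lemma invariant_step D W x : invariant_at D W -> x \in W -> 0 < wsum x D ->
  invariant_at (x |: D) (W :\ x).
Proof.
move=> [dW c inv] xW x0; have xD : x \notin D by rewrite (disjointFl dW).
split.
- rewrite disjoint_setU1 !inE eqxx /=.
  exact: disjointWr (subD1set _ _) dW.
- by apply: conn_sub c; rewrite ?setU1D1 ?subD1set.
rewrite setUC; apply: (@swap_inv_slice _ _ _ _ _ _ set0 (fun=> wsum x D) (fun=> 0)) => //.
- by rewrite setU0 setD1K //; apply: swap_inv_sub inv; apply: subD1set.
- exact: burn1.
- by rewrite disjoints1 !inE eqxx.
- exact: burn0.
Qed.

(** All other vertices of [W] burn after [u] and [v] and are deleted, which leaves a graph on the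
    root, [u] and [v]. *)
Lemma invariant_pair D W u v : invariant_at D W -> u \in W -> v \in W ->
  0 < wsum u D -> 0 < wsum v (u |: D) -> swap_inv G [set u; v] D [set u; v].
Proof.
move=> [dW c inv] uW vW u0 v0.
have E : [set u; v] :|: W :\ u :\ v = W.
  apply/setP=> z; rewrite !inE.
  by case: eqP => [->|_]; case: eqP => [->|_]; rewrite ?uW ?vW ?orbT.
have [||h bh] := conn_burn (G := G) (D := D :|: [set u; v]) (W := W :\ u :\ v).
- rewrite disjoints_subset; apply/subsetP=> z; rewrite !inE.
  by case/or3P=> [zD|->|->]; rewrite ?andbF // (disjointFr dW) ?andbF.
- by apply: conn_sub c; [rewrite -setUA E | rewrite setDDl subsetDl].
rewrite -[D]setU0.
apply: (@swap_inv_slice _ _ _ _ set0 _ (W :\ u :\ v) (fun=> 0) h) => //.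
- rewrite set0U E; apply: swap_inv_sub inv.
  by apply/subsetP=> z; rewrite !inE => /orP[] /eqP->.
- exact: burn0.
- by rewrite -setI_eq0 set0I.
- by rewrite setU0.
Qed.

Lemma burn_pair g D u v : u != v -> burn g D [set u; v] ->
  [/\ g u = wsum u D, g v = wsum v D + wt u v & 0 < wsum u D] \/
  [/\ g v = wsum v D, g u = wsum u D + wt u v & 0 < wsum v D].
Proof.
have suff2 u' v' : u' != v' -> u' \notin D -> burn g (u' |: D) ([set u'; v'] :\ u') ->
    g v' = wsum v' D + wt u' v'.
  move=> uv uD; rewrite setU1K ?inE // => /burnP[|z]; first by rewrite -cards_eq0 cards1.
  by case; rewrite inE => /eqP-> _ _ -> _; rewrite wsumU1 // wt_sym addnC.
move=> uv /burnP[|x]; first by rewrite -cards_eq0 cards2.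
case; rewrite !inE => /orP[] /eqP-> xD x0 gx bx; [left|right]; split=> //.
  exact: suff2 bx.
by rewrite wt_sym; apply: suff2; rewrite 1?eq_sym // [_ |: [set u]]setUC.
Qed.

(** Let [u] burn before [v] and swap their values: the result must again be a burning, in one of the
    two orders, and each order gives an equation. When both vertices are adjacent to [D], exchanging
    their roles leaves only equality. *)
Lemma pair_weights D W u v : invariant_at D W -> u \in W -> v \in W -> u != v ->
  0 < wsum u D -> 0 < wsum v D + wt u v ->
  wsum u D = wsum v D \/ (wsum v D = 0 /\ wt u v = wsum u D).
Proof.
move=> inv uW vW uv u0 v0.
have [dW _ _] := inv.
have ND x : x \in W -> x \notin D by move=> xW; rewrite (disjointFl dW).
have sw u' v' : u' \in W -> v' \in W -> u' != v' ->
    0 < wsum u' D -> 0 < wsum v' D + wt u' v' ->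
    (wsum v' D + wt u' v' = wsum u' D) \/ wsum u' D = wsum v' D.
  move=> {}uW {}vW {}uv {}u0 {}v0.
  have v1 : wsum v' (u' |: D) = wsum v' D + wt u' v'.
    by rewrite wsumU1 ?ND // wt_sym addnC.
  have pinv : swap_inv G [set u'; v'] D [set u'; v'].
    by apply: (invariant_pair inv); rewrite ?v1.
  pose g z := if z == u' then wsum u' D else wsum v' D + wt u' v'.
  have vu : v' == u' = false by rewrite eq_sym (negPf uv).
  have bg : burn g D [set u'; v'].
    apply: (burnS (x := u')); rewrite ?setU11 ?ND // /g ?eqxx //.
    rewrite setU1K ?inE //; apply: burn1; rewrite ?inE ?vu ?ND ?v1 //=.
  have := pinv g u' v' (setU11 _ _) _ bg; rewrite !inE eqxx orbT => /(_ isT).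
  by case/(burn_pair uv); rewrite tpermL tpermR /g eqxx vu => -[]; lia.
have [v1|v1] := posnP (wsum v D).
  by have [] := sw _ _ uW vW uv u0 v0; lia.
have := sw _ _ uW vW uv u0 v0; rewrite eq_sym in uv.
have := sw _ _ vW uW uv v1; rewrite (wt_sym G v u) => /(_ _) []; lia.
Qed.

(** Let [x] burn first. The vertex that burns last has its full degree as value, and moving this
    value to [x] exceeds the bound on [x]. *)
Lemma swap_light D W x : invariant_at D W -> x \in W -> 0 < wsum x D ->
  W :\ x != set0 -> (forall g, burn g D W -> g x <= wsum x D) ->
  {in W :\ x, forall z, wsum x D < wsum z (D :|: W)} -> False.
Proof.
move=> inv xW x0 W0 light heavy.
have [dW c sinv] := inv; have [dW' c' _] := invariant_step inv xW x0.
have xD : x \notin D by rewrite (disjointFl dW).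
have [||g bg gx] := burn_extend (f := fun=> wsum x D) (burn1 xD x0 (erefl _)) (W := W :\ x).
- by rewrite setUC.
- by rewrite setUC.
rewrite setD1K // in bg.
have bx : burn g (x |: D) (W :\ x).
  by apply: burn_contract1 => //; rewrite gx // inE.
have [|z [I [zW _ gz _ zI]]] := burn_last bx (Z := setT).
  by rewrite -setI_eq0 setTI.
rewrite setTI in zW; rewrite setTI setU1D1 // in zI.
have /setD1P[zx zW'] := zW.
have := light _ (sinv _ x z xW zW' bg); rewrite tpermL leqNgt => /negP[].
apply: leq_trans (heavy _ zW) _; rewrite gz.
apply: leq_trans (wsum_sub G z zI) _.
have [zI'|zI'] := boolP (z \in x |: D :|: I); last by rewrite wsumU1 // wt_loopless.
by rewrite (setUidPr _) // sub1set.
Qed.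

Definition zero_or a n := (n == 0) || (n == a).

(** Weights being 0 or [a], the constant burning says that each new vertex is joined to the burnt
    set by exactly one edge of weight [a]: the graph with [D] contracted is a tree. *)
Definition tree_like a D W :=
  [/\ {in W, forall x, zero_or a (wsum x D)}, {in W &, forall x y, zero_or a (wt x y)}
    & burn (fun=> a) D W].

(** [s] lists the cycle with the contracted root removed; the neighbours of the root are the two
    ends of [s]. *)
Definition cycle_like a D W := exists s,
  [/\ uniq s, 1 < size s, W = [set z in s],
      forall z0 i, i < size s ->
        wsum (nth z0 s i) D = if (i == 0) || (i.+1 == size s) then a else 0
    & forall z0 i j, i < size s -> j < size s ->
        wt (nth z0 s i) (nth z0 s j) = if (i.+1 == j) || (j.+1 == i) then a else 0].

(** The case of a single vertex is left to [tree_like]. *)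
Definition complete_like a b D W :=
  [/\ 0 < b, 1 < #|W|, {in W, forall x, wsum x D = a}
    & {in W &, forall x y, x != y -> wt x y = b}].

Lemma cycle_like_degree a D W : 0 < a -> [disjoint D & W] -> cycle_like a D W ->
  {in W, forall z, a < wsum z (D :|: W)}.
Proof.
move=> a0 dW [s [us s1 Ws sD sW]] z; rewrite wsumU //.
rewrite {1}Ws inE => zs.
have [i si <-] : exists2 i, i < size s & nth z s i = z by apply/nthP.
have inW j : j < size s -> nth z s j \in W by move=> sj; rewrite Ws inE mem_nth.
have nb j : j < size s -> (i.+1 == j) || (j.+1 == i) -> a <= wsum (nth z s i) W.
  by move=> sj ij; rewrite (leq_trans _ (wsum_ge G _ (inW j sj))) // sW // ij.
rewrite sD //; case: ifP => [/orP[/eqP i0|/eqP i1]|/norP[i0 i1]].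
- by rewrite -[ltnLHS]addn0 ltn_add2l (leq_trans a0) // (nb 1) // i0.
- rewrite -[ltnLHS]addn0 ltn_add2l (leq_trans a0) // (nb i.-1) //; first by lia.
  by rewrite prednK ?eqxx ?orbT //; lia.
have i2 : i.-1 < size s by lia.
have i3 : i.+1 < size s by lia.
rewrite (wsumD1 _ _ (inW _ i2)) sW // prednK ?lt0n // eqxx orbT.
have : nth z s i.+1 \in W :\ nth z s i.-1.
  by rewrite !inE inW // nth_uniq // andbT; lia.
by move/(wsum_ge G (nth z s i)); rewrite sW // eqxx /=; lia.
Qed.

Lemma complete_like_degree a b D W : [disjoint D & W] -> complete_like a b D W ->
  {in W, forall z, a < wsum z (D :|: W)}.
Proof.
move=> dW [b0 W1 aD bW] z zW; rewrite wsumU // aD // -[ltnLHS]addn0 ltn_add2l.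
move: W1; rewrite (cardsD1 z) zW ltnS => /card_gt0P[y /setD1P[yz yW]].
by apply/wsum_gt0P; exists y => //; rewrite bW // eq_sym.
Qed.

(** Contracting [x] into the root and applying [pair_weights] to the other vertices compares their
    sums of root weight and weight to [x]. In this way the weights of the triangle on the root, [u]
    and [v] spread to all of [W]. *)
Lemma complete_neighborhood D W u v : invariant_at D W -> u \in W -> v \in W ->
  0 < wsum u D -> 0 < wsum v D -> 0 < wt u v ->
  complete_like (wsum u D) (wt u v) D W.
Proof.
move=> inv uW vW u0 v0 uv0.
have [dW c _] := inv.
have ND x : x \in W -> x \notin D by move=> xW; rewrite (disjointFl dW).
have neq x y : 0 < wt x y -> x != y.
  by apply: contraTneq => ->; rewrite wt_loopless.
have aD x : x \in W -> 0 < wsum x D -> wsum x D = wsum u D.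
  move=> xW x0; have [->//|xu] := eqVneq x u.
  by case: (pair_weights inv xW uW xu x0); lia.
have same x y y' : x \in W -> y \in W -> y' \in W -> 0 < wsum x D -> 0 < wsum y D ->
    y != x -> y' != x -> 0 < wsum y' D + wt x y' -> 0 < wt x y ->
    wsum y' D + wt x y' = wsum u D + wt x y.
  move=> xW yW yW' x0 y0 yx yx' y0' xy0.
  have [->|yy] := eqVneq y' y; first by rewrite aD.
  have inv' := invariant_step inv xW x0.
  have E z : wsum z (x |: D) = wsum z D + wt x z by rewrite wsumU1 ?ND // wt_sym addnC.
  have yWx : y \in W :\ x by rewrite !inE yx.
  have yWx' : y' \in W :\ x by rewrite !inE yx'.
  rewrite eq_sym in yy; have := pair_weights inv' yWx yWx' yy.
  rewrite !E (aD y) // => pw; have [||->//|[e _]] := pw.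
  - by rewrite addn_gt0 u0.
  - by rewrite addn_gt0 y0'.
  - by rewrite e in y0'.
have vu : v != u by rewrite eq_sym neq.
(* The common weight inside N(D) propagates from the edge uv. *)
have star x y z : x \in W -> y \in W -> z \in W -> 0 < wsum x D -> 0 < wsum y D ->
    0 < wsum z D -> x != y -> z != x -> 0 < wt x y -> wt x z = wt x y.
  move=> xW yW zW x0 y0 z0 xy zx xy0; rewrite eq_sym in xy.
  have := same x y z xW yW zW x0 y0 xy zx _ xy0.
  by rewrite (aD z) // addn_gt0 u0 => /(_ isT) /addnI.
have bN x y : x \in W -> y \in W -> 0 < wsum x D -> 0 < wsum y D -> x != y ->
    wt x y = wt u v.
  move=> xW yW x0 y0 xy.
  have [xu|xu] := eqVneq x u.
    have yu : y != u by rewrite eq_sym -xu.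
    by rewrite xu; apply: star => //; apply: neq.
  have ux : wt u x = wt u v by apply: star => //; apply: neq.
  rewrite -ux (wt_sym G u x); have [->//|yu] := eqVneq y u.
  by apply: star; rewrite // ?(wt_sym G x u) ?ux // eq_sym.
(* Otherwise some [y] of root weight 0 has a neighbour [z] adjacent to the root, and [wt z y] is the
   root weight of [z]. After contracting [z], comparing [y] with a root neighbour [t] of [z] forces
   [wt z t = 0], a contradiction. *)
have WN x : x \in W -> 0 < wsum x D.
  move=> xW; rewrite lt0n; apply/negP=> x0.
  have [||y] := c [set z in W | wsum z D == 0].
  - by apply/subsetP=> z; rewrite inE => /andP[].
  - by apply/set0Pn; exists x; rewrite inE xW.
  rewrite inE => /andP[yW /eqP y0] /wsum_gt0P[z].
  rewrite !inE => /andP[zN /orP[zD|zW]] yz.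
    by have := wsum_ge G y zD; rewrite y0 leqNgt yz.
  rewrite zW -lt0n in zN.
  have zy : y != z by apply: neq.
  have [t [tW t0 tz zt]] : exists t, [/\ t \in W, 0 < wsum t D, t != z & 0 < wt z t].
    have [zu|zu] := eqVneq z u; first by exists v; rewrite zu.
    by exists u; rewrite eq_sym zu bN.
  have := pair_weights inv zW yW; rewrite eq_sym y0 add0n (wt_sym G z y).
  move=> /(_ zy zN yz)[e|[_ zy']]; first by rewrite e in zN.
  have := same z t y zW tW yW zN t0 tz zy; rewrite y0 (wt_sym G z y) zy'.
  rewrite (aD z) // add0n => /(_ u0 zt) /eqP.
  by rewrite -[eqbLHS]addn0 eqn_add2l => /eqP e; rewrite -e in zt.
split=> //.
- apply: (@leq_trans #|[set u; v]|); first by rewrite cards2 eq_sym vu.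
  by apply/subset_leq_card/subsetP=> z; rewrite !inE => /orP[] /eqP->.
- by move=> x xW; apply: aD (WN _ xW).
- by move=> x y xW yW; apply: bN; rewrite ?WN.
Qed.


End NeighborhoodOfRoot.

(** * Classification of graphs with invariant parking functions *)

Section Classification.
Variables (V : finType) (G : wgraph V).
Implicit Types (x y z u v : V) (D W I X U Z P : {set V}) (g h f : V -> nat).
Implicit Types (a b : nat) (s : seq V).

Local Notation wt := (wt G).
Local Notation wsum := (wsum G).
Local Notation burn := (burn G).

Definition classified a D W :=
  [\/ tree_like G a D W, cycle_like G a D W | exists b, complete_like G a b D W].

Lemma classified_weight a D W x : classified a D W -> x \in W -> 0 < wsum x D ->
  wsum x D = a.
Proof.
case=> [[aD _ _]|[s [us _ Ws sD _]]|[b [_ _ aD _]]] xW; last by rewrite aD.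
  by rewrite lt0n => x0; have := aD _ xW; rewrite /zero_or (negPf x0) => /eqP.
have xs : x \in s by rewrite Ws inE in xW.
rewrite -(nth_index x xs) sD ?index_mem //; by case: ifP.
Qed.

(** In the contracted cycle the root has two neighbours. The hypotheses say that one of these edges
    comes from [x] and the other from [D], so [x] fits between the root and one end of the list. *)
Lemma cycle_like_extend a D W x : x \in W -> x \notin D -> wsum x D = a ->
  cycle_like G a (x |: D) (W :\ x) ->
  {in W :\ x, forall y, wsum y D = 0 \/ wt x y = 0} ->
  (exists2 y, y \in W :\ x & 0 < wt x y) ->
  (exists2 y, y \in W :\ x & 0 < wsum y D) ->
  cycle_like G a D W.
Proof.
move=> xW xD xa [s [us s1 Ws sD sW]] excl [y yW xy] [z zW z0].
have sDx t i : i < size s -> wsum (nth t s i) D + wt x (nth t s i) =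
    if (i == 0) || (i.+1 == size s) then a else 0.
  by move=> si; rewrite -(sD t i) // wsumU1 // wt_sym addnC.
have sX i t : i < size s -> wsum (nth t s i) D = 0 \/ wt x (nth t s i) = 0.
  by move=> si; apply: excl; rewrite Ws inE mem_nth.
have xs : x \notin s.
  apply/negP=> xs; have : x \in W :\ x by rewrite Ws inE.
  by rewrite !inE eqxx.
have [i si yi] : exists2 i, i < size s & nth x s i = y.
  by apply/nthP; rewrite Ws inE in yW.
have [j sj zj] : exists2 j, j < size s & nth x s j = z.
  by apply/nthP; rewrite Ws inE in zW.
have Wxs : W = [set t in x :: s].
  by rewrite -(setD1K xW) Ws; apply/setP=> t; rewrite !inE.
have dflt t k : k < size s -> nth t s k = nth x s k by move=> sk; apply: set_nth_default.
have i_end : (i == 0) || (i.+1 == size s).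
  by have := sDx x i si; rewrite yi; case: ifP => // _; lia.
have j_end : (j == 0) || (j.+1 == size s).
  by have := sDx x j sj; rewrite zj; case: ifP => // _; lia.
have ij : i <> j.
  move=> ij; have zy : z = y by rewrite -zj -ij.
  by have := excl _ yW; rewrite zy in z0; lia.
have ei := sX i x si; have ej := sX j x sj; rewrite yi in ei; rewrite zj in ej.
have iE : wsum y D = 0 /\ wt x y = a.
  by have := sDx x i si; rewrite yi i_end; lia.
have jE : wsum z D = a /\ wt x z = 0.
  by have := sDx x j sj; rewrite zj j_end; lia.
have mid k : k < size s -> k != i -> k != j ->
    wsum (nth x s k) D = 0 /\ wt x (nth x s k) = 0.
  by move=> sk ki kj; have := sDx x k sk; rewrite ifF; lia.
have Dk k : k < size s -> wsum (nth x s k) D = if k == j then a else 0.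
  move=> sk; case: eqVneq => [->|kj]; first by rewrite zj jE.1.
  by have [->|ki] := eqVneq k i; [rewrite yi iE.1 | exact: (mid k sk ki kj).1].
have xk k : k < size s -> wt x (nth x s k) = if k == i then a else 0.
  move=> sk; case: eqVneq => [->|ki]; first by rewrite yi iE.2.
  by have [->|kj] := eqVneq k j; [rewrite zj jE.2 | exact: (mid k sk ki kj).2].
(* [i] is the position of the neighbour of [x]: if it is the first one, [x] is put in front of [s],
   otherwise at the end. *)
have [i0|i0] := eqVneq i 0.
  exists (x :: s); split; rewrite ?ltnS ?(ltnW s1) //=; first by rewrite xs.
    move=> t [|k] //=; rewrite !ltnS => sk.
    by rewrite dflt // Dk // eqSS; congr (if _ then _ else _); lia.
  move=> t [|k] [|l] //=; rewrite ?ltnS => sk sl; rewrite ?wt_loopless //.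
  - by rewrite dflt // xk // i0 orbF eqSS eq_sym.
  - by rewrite wt_sym dflt // xk // i0 eqSS eq_sym.
  - by rewrite sW // !eqSS.
have [j0 {}i0] : j = 0 /\ i.+1 = size s by lia.
exists (rcons s x); split; rewrite ?size_rcons ?rcons_uniq ?xs ?ltnS ?(ltnW s1) //.
- by rewrite Wxs; apply/setP=> t; rewrite !inE mem_rcons inE.
- move=> t k sk; rewrite nth_rcons; case: (ltngtP k (size s)) => [ks|ks|ks]; last 1 first.
  + by rewrite ks eqxx orbT.
  + by rewrite dflt // Dk // j0 eqSS (ltn_eqF ks) orbF.
  + by rewrite ltnS leqNgt ks in sk.
move=> t k l sk sl; rewrite !nth_rcons; rewrite !ltnS in sk sl.
case: (ltngtP k (size s)) sk => // ks _; case: (ltngtP l (size s)) sl => // ls _.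
- exact: sW.
- by rewrite wt_sym dflt // xk // ls -i0 !eqSS; congr (if _ then _ else _); lia.
- by rewrite dflt // xk // ks -i0 !eqSS; congr (if _ then _ else _); lia.
- by rewrite wt_loopless ks ls; case: ifP => //; lia.
Qed.

(* The contracted graph is complete, and only the edges from [x] and [y] to the
   root survive: with two further vertices [z] and [z'], whose values exceed the
   weight of these two edges, moving the values of [z] and [z'] to [x] and [y]
   leaves no vertex that can burn first. *)
Lemma no_two_far_vertices D W x y z z' : invariant_at G D W ->
  x \in W -> y \in W -> z \in W -> z' \in W -> uniq [:: x; y; z; z'] ->
  0 < wsum x D -> 0 < wsum y D ->
  {in W, forall t, t != x -> t != y -> wsum t D = 0} ->
  wsum x D = wsum y D ->
  wsum x D < wsum z (y |: (x |: D)) -> wsum x D < wsum z' (y |: (x |: D)) ->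
  False.
Proof.
move=> inv xW yW zW zW'; rewrite /= !inE !negb_or -!andbA.
case/and5P=> xy xz xz' yz /andP[yz' /andP[zz' _]] x0 y0 far xya big big'.
have yx : y != x by rewrite eq_sym.
have yWx : y \in W :\ x by rewrite !inE yx.
have inv1 := invariant_step inv xW x0.
have y1 : 0 < wsum y (x |: D) by apply: leq_trans y0 (wsum_sub _ _ (subsetUr _ _)).
have [dW c _] := invariant_step inv1 yWx y1.
have [dW0 _ sinv] := inv; have [dW1 _ _] := inv1.
have [h bh] := conn_burn dW c.
pose g t := if t == x then wsum x D else if t == y then wsum y (x |: D) else h t.
have bg : burn g D W.
  apply: (burnS xW); rewrite ?(disjointFl dW0) /g ?eqxx //.
  apply: (burnS yWx); rewrite ?(disjointFl dW1) ?(negPf yx) ?eqxx //.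
  apply: burn_ext bh => t; rewrite !inE => /and3P[ty tx _].
  by rewrite (negPf ty) (negPf tx).
have gz t : t \in W -> x != t -> y != t -> wsum t (y |: (x |: D)) <= g t.
  move=> tW xt yt; rewrite /g eq_sym (negPf xt) eq_sym (negPf yt).
  by apply: burn_lower bh _; rewrite !inE eq_sym yt eq_sym xt.
have {}bg := sinv _ y z' yW zW' (sinv _ x z xW zW bg).
have /burnP[|t [tW _ t0 gt _]] := bg; first by apply/set0Pn; exists x.
have [tx|tx] := eqVneq t x.
  move: gt; rewrite tx [tperm y z' x]tpermD ?tpermL // 1?eq_sym // => gt.
  by have := leq_trans big (gz z zW xz yz); rewrite gt ltnn.
have [ty|ty] := eqVneq t y.
  move: gt; rewrite ty tpermL tpermD // => gt.
  by have := leq_trans big' (gz z' zW' xz' yz'); rewrite gt xya ltnn.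
by rewrite far in t0.
Qed.

(* Contract an edge at the root and classify the rest: the only graphs that
   can be expanded back are of the same shape. *)
Theorem invariant_classified D W : invariant_at G D W -> W != set0 ->
  exists2 a, 0 < a & classified a D W.
Proof.
have [n] := ubnP #|W|; elim: n D W => // n IH D W; rewrite ltnS => Wn inv W0.
have [dW c sinv] := inv.
have [x xW x0] := conn_next dW c W0; pose a := wsum x D.
have xD : x \notin D by rewrite (disjointFl dW).
(* Two adjacent neighbours of the root force the complete case; otherwise the neighbours of the root
   are pairwise non-adjacent. *)
have [/exists_inP[u uW /exists_inP[v vW /and3P[u0 v0 uv]]]|indep] :=
  boolP [exists u in W, exists v in W, [&& 0 < wsum u D, 0 < wsum v D & 0 < wt u v]].
  exists (wsum u D) => //; apply: Or33; exists (wt u v).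
  exact: complete_neighborhood.
have {}indep u v : u \in W -> v \in W -> 0 < wsum u D -> 0 < wsum v D -> wt u v = 0.
  move=> uW vW u0 v0; apply/eqP; rewrite -leqn0 leqNgt; apply: contra indep => uv.
  by apply/exists_inP; exists u => //; apply/exists_inP; exists v; rewrite ?u0 ?v0.
exists a => //.
have tri y : y \in W :\ x -> (wsum y D = a /\ wt x y = 0) \/
    (wsum y D = 0 /\ (wt x y = 0 \/ wt x y = a)).
  move=> /setD1P[yx yW]; rewrite eq_sym in yx.
  have [y0|y0] := posnP (wsum y D).
    right; split=> //; have [->|xy] := posnP (wt x y); first by left.
    by have := pair_weights inv xW yW yx x0; rewrite y0 -/a => /(_ xy); lia.
  left; split; last exact: indep.
  by have := pair_weights inv xW yW yx x0; rewrite -/a => /(_ _)[]; lia.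
have E y : wsum y (x |: D) = wsum y D + wt x y by rewrite wsumU1 // wt_sym addnC.
have [Wx|Wx] := eqVneq (W :\ x) set0.
  have Wx1 : W = [set x] by rewrite -(setD1K xW) Wx setU0.
  apply: Or31; split; rewrite Wx1; last exact: burn1.
    by move=> y /set1P->; rewrite /zero_or -/a eqxx orbT.
  by move=> y z /set1P-> /set1P->; rewrite wt_loopless.
have inv1 := invariant_step inv xW x0; have [dW1 c1 _] := inv1.
have [|//|a' a0' cl] := IH _ _ _ inv1; first by rewrite (cardsD1 x) xW in Wn.
have aa : a' = a.
  have [y yW y0] := conn_next dW1 c1 Wx.
  by rewrite -(classified_weight cl yW y0) E; have := tri _ yW; rewrite E in y0; lia.
rewrite {a'}aa in a0' cl.
(* When all other degrees exceed [a], [swap_light] excludes two situations that keep the value of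
   [x] at most [a]: [x] has no neighbour in [W], or [x] is the only neighbour of the root and so
   burns first. *)
have light : {in W :\ x, forall z, a < wsum z (x |: D :|: W :\ x)} ->
    (exists2 y, y \in W :\ x & 0 < wt x y) /\ (exists2 y, y \in W :\ x & 0 < wsum y D).
  rewrite setU1D1 // => deg; split; [apply/wsum_gt0P | apply/exists_inP]; apply: contraT.
    rewrite -eqn0Ngt => /eqP xW0; exfalso.
    apply: (swap_light inv xW x0 Wx _ deg) => g bg.
    apply: leq_trans (burn_upper bg xW) _.
    by rewrite wsumU // (wsumD1 _ _ xW) wt_loopless xW0 !addn0.
  move=> /exists_inPn WD; exfalso.
  apply: (swap_light inv xW x0 Wx _ deg) => g bg.
  have WDE : (D :|: W) :\: W = D by rewrite setDUl setDv setU0 (setDidPl dW).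
  rewrite -[in leqRHS]WDE; apply: (burn_gate bg) => // y yW yx; rewrite WDE.
  by apply/eqP; have := WD y; rewrite lt0n negbK; apply; rewrite !inE yx.
case: cl => [[aD aW ba]|cl|[b cl]].
- apply: Or31; split.
  + move=> y yW; have [->|yx] := eqVneq y x; first by rewrite /zero_or eqxx orbT.
    have := tri y; rewrite !inE yx yW /zero_or => /(_ isT)[][-> _]; first by rewrite eqxx orbT.
    by rewrite eqxx.
  + have xy y : y \in W -> zero_or a (wt x y).
      move=> yW; have [->|yx] := eqVneq y x; first by rewrite wt_loopless.
      have := tri y; rewrite !inE yx yW /zero_or => /(_ isT)[[_ ->]|[_ []->]] //.
      by rewrite eqxx orbT.
    move=> y z yW zW; have [->|yx] := eqVneq y x; first exact: xy.
    have [->|zx] := eqVneq z x; first by rewrite wt_sym; apply: xy.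
    by apply: aW; rewrite !inE ?yx ?zx.
  + exact: burnS ba.
- have [e1 e2] := light (cycle_like_degree a0' dW1 cl).
  apply: Or32; apply: (cycle_like_extend xW xD (erefl a) cl) => // y /tri.
  by case=> -[]; [right | left].
(* The contracted graph is complete. Besides [x], only [y] is adjacent to the root, and comparing
   [y] with [z] gives [b = a]. *)
have [[z zW xz] [y yW y0]] := light (complete_like_degree dW1 cl).
have [b0 _ aD bW] := cl.
have [yx yW'] := setD1P yW; have [zx zW'] := setD1P zW.
have yE : wsum y D = a /\ wt x y = 0.
  by case: (tri y yW) => // -[yD]; rewrite yD in y0.
have zE : wsum z D = 0 /\ wt x z = a.
  by case: (tri z zW) => -[zD xz0]; [|case: xz0 => // xz0]; rewrite xz0 in xz.
have yz : y != z by apply: contraTneq xz => <-; rewrite yE.2.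
have far t : t \in W :\ x -> t != y -> wsum t D = 0.
  move=> tW ty; have [_ tW'] := setD1P tW.
  have := indep t y tW' yW'; rewrite bW // => /(_ _ y0) h.
  by case: posnP h => // _ /(_ isT) b_0; rewrite b_0 in b0.
have ba : b = a.
  have := pair_weights inv yW' zW' yz y0; rewrite bW // zE.1 yE.1.
  by move=> /(_ b0)[a_0|[]//]; rewrite a_0 in a0'.
(* If only [y] and [z] remain, the contracted graph is a triangle of constant weight, which is a
   cycle and expands to a 4-cycle. A further vertex [z'] is excluded by [no_two_far_vertices]. *)
have [Wzy|[z' zW1]] := set_0Vmem (W :\ x :\ y :\ z).
  apply: Or32; apply: (cycle_like_extend xW xD (erefl a)); last first.
  - by exists y.
  - by exists z.
  - by move=> t /tri[] []; [right | left].
  exists [:: z; y].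
  have WE : W :\ x = [set z; y].
    have zWy : z \in W :\ x :\ y by rewrite in_setD1 eq_sym yz.
    by rewrite -(setD1K yW) -(setD1K zWy) Wzy setU0 setUC.
  split=> //; first by rewrite /= inE eq_sym yz.
  + by rewrite WE; apply/setP=> t; rewrite !inE.
  + by move=> t [|[|]] //= _; apply: aD.
  + by move=> t [|[|]] // [|[|]] //= _ _; rewrite ?wt_loopless // bW // 1?eq_sym.
have /setD1P[zz' /setD1P[zy' zW2]] := zW1; have [zx' zW3] := setD1P zW2.
have zE' : wsum z' D = 0 /\ wt x z' = a.
  by have := aD z' zW2; rewrite E far.
exfalso; apply: (no_two_far_vertices inv xW yW' zW' zW3 _ x0 y0).
- by rewrite /= !inE !negb_or yz !(eq_sym x) yx zx zx' (eq_sym y z') zy' eq_sym zz'.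
- by move=> t tW tx ty; apply: far; rewrite // !inE tx.
- by rewrite yE.1.
- rewrite wsumU1 ?E ?zE.1 ?zE.2 ?(bW z y) // -/a 1?eq_sym //.
    by rewrite add0n -[ltnLHS]add0n ltn_add2r.
  by rewrite !inE negb_or yx (disjointFl dW).
- rewrite wsumU1 ?E ?zE'.1 ?zE'.2 ?(bW z' y) // -/a.
    by rewrite add0n -[ltnLHS]add0n ltn_add2r.
  by rewrite !inE negb_or yx (disjointFl dW).
Qed.
End Classification.

(** * Cut vertices *)

Section CutVertices.
Variables (V : finType) (G : wgraph V).
Implicit Types (x y z u v : V) (D W I X U Z P C : {set V}) (g h f : V -> nat).
Implicit Types (a b : nat) (s : seq V) (chi : V -> bool).

Local Notation wt := (wt G).
Local Notation wsum := (wsum G).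
Local Notation burn := (burn G).

(** Connectedness is expressed by colourings constant along edges: a cycle or a complete graph stays
    connected when its root is removed. *)
Lemma ring_like_mono a D W chi : 0 < a ->
  cycle_like G a D W \/ (exists b, complete_like G a b D W) ->
  {in W &, forall x y, 0 < wt x y -> chi x = chi y} ->
  {in W &, forall x y, chi x = chi y}.
Proof.
move=> a0 [[s [us s1 Ws sD sW]]|[b [b0 _ _ bW]]] cW; last first.
  by move=> x y xW yW; have [->//|xy] := eqVneq x y; apply: cW; rewrite ?bW.
move=> x y; rewrite Ws !inE => xs ys.
suff H z : z \in s -> chi z = chi (nth x s 0) by rewrite !H.
move=> zs; have : index z s < size s by rewrite index_mem.
rewrite -{2}(nth_index x zs); elim: (index z s) => //= n IH sn.
have sn' := ltnW sn; rewrite -IH //.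
by apply: cW; rewrite ?Ws ?inE ?mem_nth // sW ?eqxx ?orbT.
Qed.

(** Deleting a vertex [k] other than the root also leaves the graph connected; [t] is the colour on
    the side of the root. *)
Lemma ring_like_mono_del a D W k chi t : 0 < a ->
  cycle_like G a D W \/ (exists b, complete_like G a b D W) -> k \in W ->
  {in W :\ k &, forall x y, 0 < wt x y -> chi x = chi y} ->
  {in W :\ k, forall x, 0 < wsum x D -> chi x = t} ->
  {in W :\ k, forall x, chi x = t}.
Proof.
move=> a0 [[s [us s1 Ws sD sW]]|[b [_ _ aD _]]] kW cW cD x xW; last first.
  by apply: cD => //; rewrite aD //; case/setD1P: xW.
have ks : k \in s by rewrite Ws inE in kW.
pose m := index k s; have ms : m < size s by rewrite index_mem.
have inW i : i < size s -> i != m -> nth k s i \in W :\ k.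
  move=> si im; rewrite !inE Ws inE mem_nth // andbT -[k in _ == k](nth_index k ks).
  by rewrite nth_uniq.
have xs : x \in s by move: xW; rewrite !inE Ws inE => /andP[].
have : index x s < size s by rewrite index_mem.
have : index x s != m.
  apply/eqP=> xm; move: xW; rewrite -(nth_index k xs) xm nth_index //.
  by rewrite !inE eqxx.
rewrite -{3}(nth_index k xs); move: (index x s) => i im si.
(* Vertices before [k] are traced back to the start of the list, those after [k] on to its end; both
   ends are adjacent to the root. *)
have [im'|mi] := ltnP i m.
  elim: i si im im' => [|i IH] si im im'; first by apply: cD; rewrite ?inW ?sD.
  rewrite -IH; try lia.
  apply: cW; rewrite ?inW //; try lia.
  by rewrite sW ?eqxx ?orbT //; lia.
have [n ni] : exists n, n + i.+1 = size s by exists (size s - i.+1); lia.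
elim: n i ni si im mi => [|n IH] i ni si im mi.
  by apply: cD; rewrite ?inW ?sD // -ni eqxx orbT.
rewrite -(IH i.+1); try lia.
apply: cW; rewrite ?inW //; try lia.
by rewrite sW ?eqxx //; lia.
Qed.

(** As long as [k] is not burnt, the fire cannot cross the cut. *)
Lemma burn_same_side g D I k chi t : burn g D I -> k \notin D :|: I ->
  (forall x y, x != k -> y != k -> 0 < wt x y -> chi x = chi y) ->
  {in D, forall x, chi x = t} -> {in D :|: I, forall x, chi x = t}.
Proof.
move=> b + cut; elim: b => {D I} [D|x D I xI xD x0 gx bI IH]; first by rewrite setU0.
rewrite -(setU1D1 _ xI) => kN Dt; apply: IH => // y; rewrite !inE.
case/orP=> [/eqP->|]; last exact: Dt.
have [z zD xz] := wsum_gt0P _ _ _ x0; rewrite -(Dt z zD).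
by apply: cut xz; apply: contraNneq kN => <-; rewrite !inE ?eqxx ?zD ?orbT.
Qed.

Definition edge_connected C := forall chi,
  {in C &, forall x y, 0 < wt x y -> chi x = chi y} -> {in C &, forall x y, chi x = chi y}.

(* A vertex on the side of the cut vertex [k] away from C, or [k] itself, hangs
   on a single tree edge towards the root, so its value never exceeds a. *)
Lemma tree_cut_light a r A C k chi q :
  tree_like G a [set r] A -> r \notin C -> [disjoint A & C] ->
  k \in r |: A -> (forall x y, x != k -> y != k -> 0 < wt x y -> chi x = chi y) ->
  {in C, forall x, chi x} -> q \in r |: A -> q != k -> ~~ chi q ->
  exists2 u, u \in A & forall g, burn g [set r] (A :|: C) -> g u <= a.
Proof.
move=> [_ _ bA] rC dAC kA cut cC qA qk cq.
have kC : k \notin C.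
  by move: kA; rewrite !inE => /orP[/eqP->|/(disjointFr dAC)->].
have side x y : x != k -> y != k -> chi x != chi y -> wt x y = 0.
  move=> xk yk; apply: contraNeq; rewrite -lt0n => xy.
  by apply/eqP; apply: cut.
have loop x y : 0 < wt x y -> y != x by apply: contraTneq => ->; rewrite wt_loopless.
(* If the root is [k] or on the side of [C], take for [u] the last vertex across the cut to burn.
   The fire has passed [k] before reaching it, so all neighbours of [u] are burnt and its degree is
   at most [a]. *)
have [rP|] := boolP ((r == k) || chi r).
  pose Z := [set x in r |: A | (x != k) && ~~ chi x].
  have qr : q != r by case/orP: rP => [/eqP->|]//; apply: contraTneq => <-.
  have qA' : q \in A by move: qA; rewrite !inE (negPf qr).
  have [|u [I [uZ bI ua u0 Zu]]] := burn_last bA (Z := Z).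
    by apply/pred0Pn; exists q; rewrite /= !inE qA' qk cq orbT.
  have [uZ' uA] := setIP uZ; have : u \in Z by [].
  rewrite inE => /and3P[_ uk cu]; exists u => // g bg.
  apply: leq_trans (burn_upper bg _) _; first by rewrite inE uA.
  rewrite ua; apply: wsum_le_support => y yX uy.
  have [yk|yk] := eqVneq y k.
    subst y; apply: contraT => kI.
    have rk : r != k by apply: contraNneq kI => ->; rewrite !inE eqxx.
    have [z zI uz] := wsum_gt0P _ _ _ u0.
    have zk : z != k by apply: contraNneq kI => <-.
    have : chi z = true.
      apply: (burn_same_side bI kI cut) zI => t /set1P->.
      by move: rP; rewrite (negPf rk).
    by rewrite -(cut u z) // (negPf cu).
  have cy : ~~ chi y by rewrite -(cut u y).
  have : y \in u |: ([set r] :|: I).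
    apply: (subsetP Zu); move: yX; rewrite !inE yk cy.
    by case/or3P=> [->|->|/cC]; rewrite ?orbT // (negPf cy).
  by rewrite in_setU1 (negPf (loop _ _ uy)).
(* Now the root itself is across the cut from [C], and [u] is the last to burn among [k] and the
   vertices on the side of the root. If [u] is [k], then [burn_gate] shows that the side of [C]
   burns only after [k], so only neighbours on the side of the root count. *)
rewrite negb_or => /andP[rk cr].
have kA' : k \in A by move: kA; rewrite !inE eq_sym (negPf rk).
pose Z := [set x in r |: A | (x == k) || ~~ chi x].
have [|u [I [uZ bI ua u0 Zu]]] := burn_last bA (Z := Z).
  by apply/pred0Pn; exists k; rewrite /= !inE kA' eqxx orbT.
have [uZ' uA] := setIP uZ; have : u \in Z by [].
rewrite inE => /andP[_ ukc]; exists u => // g bg.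
have ZI y : y \in Z -> y != u -> y \in [set r] :|: I.
  move=> yZ yu; have : y \in u |: ([set r] :|: I).
    by apply: (subsetP Zu); rewrite inE yZ; move: yZ; rewrite inE => /andP[].
  by rewrite in_setU1 (negPf yu).
have [uk|uk] := eqVneq u k; last first.
  rewrite (negPf uk) in ukc.
  apply: leq_trans (burn_upper bg _) _; first by rewrite inE uA.
  rewrite ua; apply: wsum_le_support => y yX uy; apply: ZI (loop _ _ uy).
  have [->|yk] := eqVneq y k; first by rewrite !inE kA' eqxx orbT.
  have cy : ~~ chi y by rewrite -(cut u y).
  move: yX; rewrite !inE (negPf yk) cy.
  by case/or3P=> [->|->|/cC]; rewrite ?orbT // (negPf cy).
subst u; pose U := [set x in A :|: C | (x == k) || chi x].
apply: leq_trans (burn_gate bg (U := U) _ _ _) _.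
- by apply/subsetP=> x; rewrite inE => /andP[].
- by rewrite !inE kA' eqxx.
- move=> x; rewrite inE => /andP[_ xc] xk; rewrite (negPf xk) /= in xc.
  apply/eqP/wsum_eq0P=> y; rewrite !inE.
  have [->|yr] := eqVneq y r; first by rewrite side // xc (negPf cr).
  by move=> /andP[+ /= yAC]; rewrite yAC negb_or => /andP[yk cy]; rewrite side // xc (negPf cy).
rewrite ua; apply: wsum_le_support => y yX ky; apply: ZI (loop _ _ ky).
move: yX; rewrite !inE; have [->|yr] := eqVneq y r; first by rewrite cr orbT.
move=> /andP[+ /= yAC]; rewrite yAC negb_or => /andP[yk cy].
rewrite cy orbT andbT; case/orP: yAC => // /cC; by rewrite (negPf cy).
Qed.

(* Burning C as early as possible gives a vertex of A adjacent to C a value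
   above a; moving it to a vertex that never exceeds a is impossible. *)
Lemma tree_no_cut a r A B C k chi q i1 i2 : 0 < a ->
  tree_like G a [set r] A -> swap_inv G A [set r] (A :|: B) ->
  [disjoint r |: A & B] -> conn G (r |: A) B ->
  C \subset B -> edge_connected C -> i1 \in r |: A -> i2 \in r |: A -> i1 != i2 ->
  0 < wsum i1 C -> 0 < wsum i2 C ->
  k \in r |: A -> (forall x y, x != k -> y != k -> 0 < wt x y -> chi x = chi y) ->
  {in C, forall x, chi x} -> q \in r |: A -> q != k -> ~~ chi q -> False.
Proof.
move=> a0 tA sinv dAB cB CB Cc i1A i2A i12 i1C i2C kA cut cC qA qk cq.
have [_ _ bA] := tA.
have dAC : [disjoint r |: A & C] by apply: disjointWr dAB.
have rC : r \notin C by rewrite (disjointFr dAC) // setU11.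
have dAC' : [disjoint A & C] by apply: disjointWl dAC; apply: subsetUr.
have [u uA light] := tree_cut_light tA rC dAC' kA cut cC qA qk cq.
pose N := [set i in r |: A | 0 < wsum i C].
have N1 : i1 \in N by rewrite inE i1A.
have N2 : i2 \in N by rewrite inE i2A.
(* The tree burns until a first vertex [i] adjacent to [C] is reached. Then all of [C] can burn,
   while another neighbour [j] of [C] is still unburnt. *)
have [||i [I [IA bI NI]]] := burn_first_hit bA (Z := N).
- by apply/pred0Pn; exists i1; rewrite /= N1 inE in_set1 -in_setU1.
- by rewrite (leq_trans (subset_leq_card (subsetIr _ _))) // cards1.
have [j jN ji] : exists2 j, j \in N & j != i.
  have [e|?] := eqVneq i1 i; last by exists i1.
  by exists i2 => //; rewrite -e eq_sym.
have /setIP[iN irI] : i \in N :&: ([set r] :|: I) by rewrite NI set11.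
have jI : j \notin [set r] :|: I.
  apply/negP=> jI; have : j \in N :&: ([set r] :|: I) by apply/setIP.
  by rewrite NI inE (negPf ji).
have jA : j \in A :\: I.
  move: jN jI; rewrite !inE negb_or => /andP[jrA _] /andP[jr ->].
  by rewrite (negPf jr) in jrA.
have IAE : I :|: (A :\: I) = A by rewrite -{2}(setID A I) (setIidPr IA).
have dIA : [disjoint I & A :\: I] := disjoint_setDr I A.
have bAI : burn (fun=> a) ([set r] :|: I) (A :\: I).
  by apply: burn_contract bI _ dIA _ => //; rewrite IAE.
have dIC : [disjoint [set r] :|: I & C] by apply: disjointWl dAC; apply: setUS.
have [h bC] : exists h, burn h ([set r] :|: I) C.
  apply: conn_burn => // U UC U0; have [x xU] := set0Pn _ U0.
  have [yU|] := eqVneq U C.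
    rewrite yU; move: iN; rewrite inE => /andP[_ /wsum_gt0P[y yC iy]].
    exists y => //; apply/wsum_gt0P; exists i; last by rewrite wt_sym.
    by rewrite inE (disjointFr dIC irI) inE irI.
  rewrite eqEsubset UC => /subsetPn[y yC yU].
  apply/exists_inP; apply: contraT => /exists_inPn none.
  suff : (x \in U) = (y \in U) by rewrite xU (negPf yU).
  apply: (Cc (fun z => z \in U)) yC => [v w vC wC vw|]; last exact: subsetP xU.
  have out v' w' : v' \in C -> w' \in C -> 0 < wt v' w' -> v' \in U -> w' \in U.
    move=> vC' wC' vw' vU'; apply: contraT => wU'; have := none v' vU'.
    by case/wsum_gt0P; exists w'; rewrite // !inE wU' wC' !orbT.
  by apply/idP/idP; apply: out; rewrite // wt_sym.
have dCA : [disjoint C & [set r] :|: I :|: A :\: I].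
  by rewrite -setUA IAE disjoint_sym.
have {}bAI := burn_add dCA bAI.
(* The order is [I], then [C], then the rest of the tree with values raised by the weight to [C];
   thus [j] gets more than [a]. *)
pose f x := if x \in C then h x else if x \in I then a else a + wsum x C.
have NC x : x \in A -> x \in C = false by move=> xA; rewrite (disjointFr dAC').
have bf : burn f [set r] (A :|: C).
  have -> : A :|: C = I :|: C :|: (A :\: I) by rewrite setUAC IAE.
  apply: burn_cat; [apply: burn_cat|rewrite setUA].
  - by apply: burn_ext bI => x xI; rewrite /f NC ?xI // (subsetP IA).
  - by apply: burn_ext bC => x xC; rewrite /f xC.
  - apply: burn_ext bAI => x /setDP[xA xI].
    by rewrite /f NC // (negPf xI).
have CBE : C :|: (B :\: C) = B by rewrite -{2}(setID B C) (setIidPr CB).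
have [||g bg gf] := burn_extend (W := B :\: C) bf.
- rewrite setUA disjoint_sym -setI_eq0 setIUr setU_eq0 !setI_eq0 disjoint_sym.
  rewrite (disjointWr _ dAB) ?subsetDl //=.
  by rewrite disjoint_sym disjoint_setDr.
- by apply: conn_sub cB; rewrite ?subsetDl // setUA -setUA CBE.
have dX : [disjoint A :|: C & B :\: C].
  rewrite disjoint_sym -setI_eq0 setIUr setU_eq0 !setI_eq0 disjoint_sym.
  rewrite (disjointWl (subsetUr [set r] A)) ?(disjointWr _ dAB) ?subsetDl //=.
  by rewrite disjoint_sym disjoint_setDr.
have bX := burn_contract bf gf dX bg.
have /setDP[jA' jnI] := jA.
(* Invariance is known with all of [B] present, so the swap is made on the extended burning and
   [B :\: C] is deleted afterwards. *)
rewrite -setUA CBE in bg; have {}bg := sinv _ u j uA jA' bg.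
rewrite -CBE setUA in bg.
have {}bg : burn (fun x => g (tperm u j x)) [set r] (A :|: C).
  apply: burn_delete bX _ bg => x /setDP[xB _]; have xA := disjointFl dAB xB.
  by rewrite tpermD //; apply: contraFneq xA => <-; rewrite in_setU1 ?uA ?jA' orbT.
have := light _ bg; rewrite tpermL gf ?inE ?jA' // /f NC // (negPf jnI).
move: jN; rewrite inE => /andP[_ jC].
by rewrite -[leqRHS]addn0 leq_add2l leqNgt jC.
Qed.

End CutVertices.

(** * Translation to subgraphs *)

Section Subgraphs.
Variables (V : finType) (G : wgraph V).
Implicit Types (x y z u v r : V) (D W I X U Z P C : {set V}) (g h f : V -> nat).
Implicit Types (a b : nat) (s : seq V) (H : wgraph V).

Local Notation wt := (wt G).
Local Notation wsum := (wsum G).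
Local Notation burn := (burn G).

(* The graph H restricted to D is a forest whose components each contain at
   most one vertex of D0: [col] sends every vertex to the vertex of D0 in its
   component. *)
Definition rooted_forest_on H D0 D :=
  (forall s, ucycle (adj H) s -> {subset s <= D} -> size s <= 2) /\
  exists col : V -> V, {in D0, forall x, col x = x} /\
    {in D &, forall x y, adj H x y -> col x = col y}.

Lemma unique_neighbor a x D y z : 0 < a -> wsum x D = a ->
  {in D, forall t, zero_or a (wt x t)} ->
  y \in D -> z \in D -> 0 < wt x y -> 0 < wt x z -> y = z.
Proof.
move=> a0 xa Da yD zD xy xz; apply/eqP; apply: contraT => yz.
have zDy : z \in D :\ y by rewrite !inE eq_sym yz.
have := wsum_ge G x zDy; have := Da y yD; have := Da z zD; rewrite /zero_or.
by move: xa; rewrite (wsumD1 _ _ yD); lia.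
Qed.

Lemma adj_sym H : symmetric (adj H).
Proof. by move=> x y; rewrite /adj wt_sym. Qed.

(** Each new vertex has exactly one neighbour of [G] in the set built so far, so it has at most one
    in [H]: it closes no cycle and takes the colour of that neighbour. *)
Lemma forest_grow a H D0 D W : 0 < a -> burn (fun=> a) D W ->
  {in W, forall x, {in D :|: W, forall y, zero_or a (wt x y)}} ->
  (forall x y, adj H x y -> adj G x y) -> D0 \subset D ->
  rooted_forest_on H D0 D -> rooted_forest_on H D0 (D :|: W).
Proof.
move=> a0 b + HG; elim: b => {D W} [D|x D W xW xD x0 xa bW IH] Wa D0D.
  by rewrite setU0.
move=> [acyc [col [col0 colH]]]; rewrite -(setU1D1 _ xW); apply: IH.
- by move=> y /setD1P[_ yW]; rewrite setU1D1 //; apply: Wa.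
- exact: subset_trans D0D (subsetUr _ _).
have nbr y z : y \in D -> z \in D -> adj H x y -> adj H x z -> y = z.
  move=> yD zD /HG xy /HG xz; apply: (unique_neighbor a0 (esym xa) _ yD zD xy xz) => t tD.
  by apply: Wa; rewrite // inE tD.
have xx : adj H x x = false by rewrite /adj wt_loopless.
split.
  move=> s cs sD; have [xs|xs] := boolP (x \in s); last first.
    apply: acyc => // y ys; have := sD y ys; rewrite !inE.
    by case: eqP => // yx; rewrite yx (negPf xs) in ys.
  (* With [x] rotated to the front, the second and the last entry of a cycle of length at least 3
     are both neighbours of [x] in [D], hence equal, against uniqueness. *)
  have [i s' rs] := rot_to xs; case/andP: cs.
  rewrite -(rot_cycle i) -(rot_uniq i) -(size_rot i) rs.
  have s'D y : y \in s' -> x \notin s' -> y \in D.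
    move=> ys xs'; have : y \in s by rewrite -(mem_rot i) rs inE ys orbT.
    by move/sD; rewrite !inE; case: eqP => // yx; rewrite yx (negPf xs') in ys.
  case: s' s'D {rs} => [|y s'] //; case/lastP: s' => [|s' z] // s'D.
  rewrite /= rcons_path last_rcons => /and3P[xy _ zx] /and3P[xs' ys' _].
  case/negP: ys'; rewrite (nbr y z) ?mem_rcons ?inE ?eqxx //.
  - by apply: s'D => //; rewrite inE eqxx.
  - by apply: s'D => //; rewrite inE mem_rcons inE eqxx orbT.
  - by rewrite adj_sym.
have [y yD xy] := wsum_gt0P _ _ _ x0.
(* [H] may lack the edge from [x] to [y]; then [x] has no neighbour of [H] in [D], and [y] serves as
   default. *)
pose y' := if [pick z in D | adj H x z] is Some z then z else y.
exists (fun t => if t == x then col y' else col t); split.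
  move=> t tD; rewrite ifN; first exact: col0.
  by apply: contraNneq xD => <-; apply: subsetP D0D _ tD.
have key z : z \in D -> adj H x z -> col z = col y'.
  move=> zD xz; rewrite /y'; case: pickP => [t /andP[tD xt]|/(_ z)]; last by rewrite zD xz.
  by rewrite (nbr z t).
move=> u v; rewrite !inE; case: eqVneq => [->|_] /= uD; case: eqVneq => [->|_] /= vD //.
- by move=> uv; rewrite (key v).
- by rewrite adj_sym => uv; rewrite (key u).
exact: colH.
Qed.

Lemma ucycle_verts H s : ucycle (adj H) s -> {subset s <= verts H}.
Proof.
move=> /andP[cs _] x xs; have := next_cycle cs xs; exact: wt_verts.
Qed.

Lemma rooted_forest_acyclic H D0 D : rooted_forest_on H D0 D -> verts H \subset D ->
  acyclic H.
Proof.
move=> [acyc _] HD s cs; apply: acyc => // x xs.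
exact: subsetP HD _ (ucycle_verts cs xs).
Qed.

Lemma rooted_forest_disconnected H D0 D : rooted_forest_on H D0 D -> verts H \subset D ->
  {in D0 &, forall x y, x != y -> ~~ connect (adj H) x y}.
Proof.
move=> [_ [col [col0 colH]]] HD x y xD yD; apply: contra => xy.
rewrite -(col0 x) // -(col0 y) //; case/connectP: xy => s es ->.
apply/eqP; elim: s x es {xD} => //= z s IH x /andP[xz /IH<-].
apply: colH => //; apply: (subsetP HD); first exact: wt_verts xz.
by apply: (@wt_verts _ _ _ x); rewrite wt_sym.
Qed.

(* Only the vertex r of the contracted set D is adjacent to W, so G[r |: W] is
   the graph obtained by contracting D. *)
Section SingleAttachment.
Variables (D W : {set V}) (r : V).
Hypotheses (vG : verts G = setT) (rD : r \in D) (dDW : [disjoint D & W]).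
Hypothesis onlyr : forall x y, x \in W -> y \in D -> y != r -> wt x y = 0.

Local Notation H := (induced G (r |: W)).

Lemma single_wsum x : x \in W -> wsum x D = wt x r.
Proof.
move=> xW; rewrite (wsumD1 _ _ rD) (eqP (_ : wsum x (D :\ r) == 0)) ?addn0 //.
by apply/wsum_eq0P => y /setD1P[yr yD]; apply: onlyr.
Qed.

Lemma single_root : r \notin W.
Proof. by rewrite (disjointFr dDW). Qed.

Lemma single_wt x y : x \in r |: W -> y \in r |: W -> Defs.wt H x y = wt x y.
Proof. by move=> xH yH; rewrite /= /induced_wt xH yH. Qed.

Lemma single_verts : verts H = r |: W.
Proof. by rewrite /= vG setTI. Qed.

Lemma single_adj x y : adj H x y = [&& x \in r |: W, y \in r |: W & adj G x y].
Proof. by rewrite /adj /= /induced_wt; case: (x \in _); case: (y \in _). Qed.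

Lemma single_connected : conn G D W -> connected H.
Proof.
move=> c; have cr x : x \in r |: W -> connect (adj H) r x.
  case/setU1P=> [->|xW]; first exact: connect0.
  apply: contraT => nx; have [||y] := c [set y in W | ~~ connect (adj H) r y].
  - by apply/subsetP=> y; rewrite inE => /andP[].
  - by apply/set0Pn; exists x; rewrite inE xW.
  rewrite inE => /andP[yW ny] /wsum_gt0P[z]; rewrite !inE => /andP[zN zDW] yz.
  have zr : (z \in r |: W) && connect (adj H) r z.
    rewrite !inE; case/orP: zDW => zD; last by move: zN; rewrite zD negbK orbT.
    have [->|zr] := eqVneq z r; first by rewrite connect0.
    by rewrite onlyr in yz.
  case/andP: zr => zH zr; case/negP: ny; apply: connect_trans zr (connect1 _).
  by rewrite single_adj zH !inE yW orbT adj_sym.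
apply/forall_inP=> x; rewrite single_verts => xH; apply/forall_inP=> y yH.
by apply: connect_trans (cr y yH); rewrite (sym_connect_sym (adj_sym H)) cr.
Qed.

Lemma single_tree a : 0 < a -> conn G D W -> tree_like G a D W -> x_tree a H.
Proof.
move=> a0 c [aD aW ba]; split; [exact: single_connected | split].
  apply: (@rooted_forest_acyclic _ set0 (D :|: W)).
    apply: forest_grow ba _ _ (sub0set _) _ => // [x xW y|x y|].
    - rewrite inE; case/orP=> yD; last exact: aW.
      have [->|yr] := eqVneq y r; first by rewrite -single_wsum ?aD.
      by rewrite onlyr.
    - by rewrite single_adj => /and3P[].
    split=> [[|x [|y s]] // /andP[/= /andP[xy _] /andP[xys _]] sD|].
      have {}sD t : adj H x y -> t \in [:: x; y] -> t = r.
        rewrite single_adj => /and3P[xH yH _] txy.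
        have tD : t \in D by apply: sD; move: txy; rewrite !inE orbA => ->.
        have : t \in r |: W by move: txy; rewrite !inE => /orP[]/eqP->; rewrite -in_setU1.
        by case/setU1P=> // /(disjointFl dDW); rewrite tD.
      by case/negP: xys; rewrite (sD x) // (sD y) // !inE eqxx ?orbT.
    exists (fun=> r); split=> // x; first by rewrite inE.
  by rewrite single_verts subUset sub1set inE rD subsetUr.
move=> x y xy; move: (xy); rewrite single_adj => /and3P[xH yH {}xy].
rewrite single_wt //.
suff : zero_or a (wt x y) by rewrite /zero_or; case: eqP xy; rewrite /adj; lia.
case/setU1P: xH xy => [->|xW] xy; case/setU1P: yH xy => [->|yW] xy.
- by rewrite wt_loopless.
- by rewrite wt_sym -single_wsum ?aD.
- by rewrite -single_wsum ?aD.
exact: aW.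
Qed.

Lemma single_cycle a : 0 < a -> cycle_like G a D W -> x_cycle a H.
Proof.
move=> a0 [s [us s1 Ws sD sW]]; have rs : r \notin s.
  by have := single_root; rewrite Ws inE.
have urs : uniq (r :: s) by rewrite /= rs.
have rWE : r |: W = [set i in r :: s] by rewrite Ws; apply/setP=> x; rewrite !inE.
have wtE m n : m <= size s -> n <= size s ->
    wt (nth r (r :: s) m) (nth r (r :: s) n) =
    if (nth r (r :: s) n == nth r s m) || (nth r (r :: s) m == nth r s n) then a else 0.
  (* Reading [s] past its end returns the default [r], so [nth r s k] is the cyclic successor of
     entry [k] of [r :: s]. *)
  have nxt k : nth r s k = nth r (r :: s) (if k < size s then k.+1 else 0).
    by case: ltnP => // sk; rewrite nth_default.
  move=> ms ns; rewrite !nxt !nth_uniq //=; try by [case: ifP | rewrite ltnS].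
  case: m ms => [|m] ms; case: n ns => [|n] ns.
  - by rewrite wt_loopless (ltnW s1).
  - rewrite /= wt_sym -single_wsum ?sD ?Ws ?inE ?mem_nth // (ltnW s1).
    congr (if _ then _ else _); case: ltnP; lia.
  - rewrite /= -single_wsum ?sD ?Ws ?inE ?mem_nth // (ltnW s1).
    congr (if _ then _ else _); case: ltnP; lia.
  rewrite /= sW //; congr (if _ then _ else _).
  by case: (ltnP m.+1 (size s)) => ?; case: (ltnP n.+1 (size s)) => ?; lia.
have nextE m : m <= size s -> next (r :: s) (nth r (r :: s) m) = nth r s m.
  by move=> ms; rewrite next_nth mem_nth // index_uniq.
have wt_next x y : x \in r :: s -> y \in r :: s ->
    wt x y = if (y == next (r :: s) x) || (x == next (r :: s) y) then a else 0.
  move=> /(nthP r)[m ms <-] /(nthP r)[n ns <-]; rewrite !nextE //; exact: wtE.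
exists (r :: s); split=> //; first by rewrite single_verts.
  move=> x y xs ys; rewrite single_adj rWE !inE -!in_cons xs ys /= /adj wt_next //.
  by case: ifP.
move=> x y; rewrite single_adj => /and3P[xH yH xy]; rewrite single_wt //.
by move: xH yH xy; rewrite rWE !in_set /adj => xH yH; rewrite wt_next //; case: ifP.
Qed.

Lemma single_complete a b : complete_like G a b D W -> complete_xy #|W| a b r H.
Proof.
move=> [_ _ aD bW]; split; rewrite ?single_verts ?setU11 ?cardsU1 ?single_root //.
move=> x y xH yH xy; rewrite single_wt //.
case/setU1P: xH xy => [->|xW] xy; case/setU1P: yH xy => [->|yW] xy.
- by rewrite eqxx in xy.
- by rewrite eqxx wt_sym -single_wsum ?aD.
- by rewrite eqxx orbT -single_wsum ?aD.
have rN t : t \in W -> (t == r) = false.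
  by move=> tW; apply: contraTF tW => /eqP->; apply: single_root.
by rewrite !rN // bW.
Qed.

Lemma single_classified a : 0 < a -> conn G D W -> classified G a D W ->
  exists2 b, 0 < b & [\/ x_tree a H, x_cycle a H | complete_xy #|W| a b r H].
Proof.
move=> a0 c [cl|cl|[b cl]]; [exists 1 | exists 1 | exists b] => //.
- by apply: Or31; apply: single_tree.
- by apply: Or32; apply: single_cycle.
- by case: cl.
- by apply: Or33; apply: single_complete.
Qed.

End SingleAttachment.

(** Once the edges inside [S] are removed, the subgraph has no edge within [A], so [forest_grow]
    starts from isolated vertices, each coloured by itself. *)
Lemma forest_attached c (S A B : {set V}) : 0 < c -> verts G = setT -> S \subset A ->
  [disjoint A & B] -> tree_like G c A B ->
  (forall x y, x \in B -> y \in A -> y \notin S -> wt x y = 0) ->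
  {in B, forall x, {in A, forall y, zero_or c (wt x y)}} ->
  attached_forest c S B G.
Proof.
move=> c0 vG SA dAB [_ cW bc] onlyS cA.
pose H := del_inner (induced G (S :|: B)) S.
have adjH x y : adj H x y =
    [&& adj G x y, x \in S :|: B, y \in S :|: B & ~~ ((x \in S) && (y \in S))].
  rewrite /adj /= /del_inner_wt /= /induced_wt.
  case: ((x \in S) && (y \in S)); first by rewrite !andbF.
  by case: (x \in S :|: B); case: (y \in S :|: B); rewrite ?andbF ?andbT.
have SBA : verts H \subset A :|: B.
  by rewrite /= vG setTI setSU.
have wtH x y : adj H x y -> Defs.wt H x y = wt x y.
  rewrite adjH /= /del_inner_wt /= /induced_wt => /and4P[_ xH yH].
  by rewrite xH yH => /negPf->.
have SB t : t \in S :|: B -> t \in A -> t \in S.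
  by case/setUP=> // /(disjointFl dAB)->.
have fH : rooted_forest_on H S (A :|: B).
  apply: forest_grow bc _ _ SA _ => // [x xB y|x y|].
  - by case/setUP=> yA; [apply: cA | apply: cW].
  - by rewrite adjH => /andP[].
  have noA x y : x \in A -> y \in A -> adj H x y = false.
    move=> xA yA; rewrite adjH; apply/and4P=> -[_ xS yS].
    by rewrite !SB.
  split=> [[|x [|y s]] // /andP[/= /andP[xy _] _] sD|].
    by move: xy; rewrite noA // sD // !inE eqxx ?orbT.
  by exists id; split=> // x y xA yA; rewrite noA.
split; last exact: rooted_forest_disconnected fH SBA.
split; first exact: rooted_forest_acyclic fH SBA.
move=> x y xy; rewrite wtH //; move: (xy); rewrite adjH => /and4P[xy' xS yS xyS].
have /setUP[xA|xB] := subsetP SBA x (wt_verts xy); last first.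
  have : zero_or c (wt x y); last by rewrite /zero_or; move: xy'; rewrite /adj; lia.
  by case/setUP: yS => yS; [apply: cA => //; apply: subsetP yS | apply: cW].
have yB : y \in B.
  case/setUP: yS => // yS; by rewrite yS SB in xyS.
have : zero_or c (wt y x); first exact: cA.
by rewrite wt_sym /zero_or; move: xy'; rewrite /adj; lia.
Qed.

End Subgraphs.

(** * From parking functions to burning orders *)

Section Parking.
Variables (V : finType) (G : wgraph V).
Implicit Types (x y z u v r : V) (D W I U Z P : {set V}) (g h b : V -> nat).

Local Notation wt := (wt G).
Local Notation wsum := (wsum G).
Local Notation burn := (burn G).

Lemma outdegE U i : outdeg G U i = wsum i (~: U).
Proof. by apply: eq_bigl => j; rewrite inE. Qed.

(** The vertex found is the first one of [U] to burn. It makes a burning, lowered by one, a parking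
    function. *)
Lemma burn_escape g D W U : burn g D W -> U \subset W -> U != set0 ->
  exists2 i, i \in U & 0 < g i <= wsum i ((D :|: W) :\: U).
Proof.
move=> b; elim: b U => {D W} [D|x D W xW xD x0 gx bW IH] U UW U0.
  by rewrite subset0 (negPf U0) in UW.
have [xU|xU] := boolP (x \in U).
  exists x => //; rewrite gx x0 wsum_sub // subsetD subsetUl /=.
  exact: disjointWr UW (burn_disjoint (burnS xW xD x0 gx bW)).
have [|//|i iU] := IH U; first by rewrite subsetD1 UW.
by rewrite setU1D1 //; exists i.
Qed.

(** This is Dhar's algorithm: the parking condition for the whole unburnt set supplies the next
    vertex to burn. *)
Lemma parking_burn b W :
  (forall U, U \subset W -> U != set0 -> exists2 i, i \in U & b i < wsum i (~: U)) ->
  exists2 h, burn h (~: W) W & {in W, forall x, b x < h x}.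
Proof.
have [n] := ubnP #|W|; elim: n W => // n IH W; rewrite ltnS => Wn pb.
have [->|W0] := eqVneq W set0.
  by exists (fun=> 0) => [|x]; [apply: burn0 | rewrite inE].
have [x xW bx] := pb W (subxx _) W0.
have [||h bh hb] := IH (W :\ x).
- by rewrite (cardsD1 x) xW in Wn.
- by move=> U UW; apply: pb; apply: subset_trans UW (subD1set _ _).
exists (fun y => if y == x then wsum x (~: W) else h y).
  apply: (burnS (x := x)); rewrite ?eqxx ?inE ?xW //; first exact: leq_ltn_trans bx.
  have -> : x |: ~: W = ~: (W :\ x) by rewrite setCD setUC.
  by apply: burn_ext bh => y /setD1P[/negPf->].
by move=> y yW; case: eqVneq => [->//|yx]; apply: hb; rewrite !inE yx.
Qed.

(** Each edge inside [W] is counted once, at its later end, whereas the right-hand side counts it at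
    both ends; hence the doubling. The total does not depend on [g]. *)
Lemma burn_sum g D W : burn g D W ->
  (\sum_(x in W) g x).*2 = \sum_(x in W) ((wsum x D).*2 + wsum x W).
Proof.
elim=> {D W} [D|x D W xW xD x0 gx bW IH]; first by rewrite !big_set0.
rewrite !(big_setD1 _ xW) /= doubleD IH gx (wsumD1 _ _ xW) wt_loopless add0n.
rewrite -addnA; congr (_ + _); rewrite -big_split /=.
apply: eq_bigr => y yW; rewrite wsumU1 // (wsumD1 _ y xW) (wt_sym G x y); lia.
Qed.

(** The swapped function, lowered by one, is a parking function, so the swapped function lies below
    some burning [h]. Both have the same sum by [burn_sum], hence they agree. *)
Lemma parking_swap_inv r P : verts G = setT -> P \subset ~: [set r] ->
  (forall u v b, u \in P -> v \in P -> parking_function G r b ->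
     parking_function G r (fun x => b (tperm u v x))) ->
  swap_inv G P [set r] (~: [set r]).
Proof.
move=> vG Pr pinv g u v uP vP bg; set W := ~: [set r] in bg *.
have VW : verts G :\ r = W by rewrite vG setTD.
have pg : parking_function G r (fun x => (g x).-1).
  move=> U; rewrite VW => UW U0; have [i iU] := burn_escape bg UW U0.
  by rewrite setUCr setTD => gi; exists i => //; rewrite outdegE; lia.
have [|h] := @parking_burn (fun x => (g (tperm u v x)).-1) W.
  move=> U UW U0; rewrite -VW in UW; have [i iU] := pinv u v _ uP vP pg U UW U0.
  by rewrite outdegE; exists i.
rewrite setCK => bh gh.
have tW x : (tperm u v x \in W) = (x \in W).
  by case: tpermP => // ->; rewrite !(subsetP Pr).
have {}gh x : x \in W -> g (tperm u v x) <= h x.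
  move=> xW; have := gh x xW.
  have : 0 < g (tperm u v x) by apply: burn_pos bg _; rewrite tW.
  lia.
have sg : \sum_(x in W) g (tperm u v x) = \sum_(x in W) h x.
  apply: double_inj; rewrite (burn_sum bh) -(burn_sum bg); congr double.
  rewrite [RHS](reindex_inj (@perm_inj _ (tperm u v))) /=.
  by apply: eq_bigl => x; rewrite tW.
have := leqif_sum (P := mem W) (fun x xW => leqif_eq (gh x xW)).
case=> _; rewrite sg eqxx => /esym/forall_inP gE.
by apply: burn_ext bh => x /gE /eqP.
Qed.

End Parking.

(** * Connectivity and cut vertices *)

Section Connectivity.
Variables (V : finType) (G : wgraph V).

Lemma connected_conn (H : wgraph V) D W : connected H -> D :|: W \subset verts H ->
  D != set0 -> [disjoint D & W] ->
  (forall x y, adj H x y -> adj G x y && (y \in D :|: W)) -> conn G D W.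
Proof.
move=> cH DWH /set0Pn[d dD] dDW HG U UW /set0Pn[u uU].
apply/exists_inP; apply: contraT => /exists_inPn none.
have uH : u \in verts H by apply: (subsetP DWH); rewrite inE (subsetP UW) ?orbT.
have dH : d \in verts H by apply: (subsetP DWH); rewrite inE dD.
have /(closed_connect (a := mem U)) : connect (adj H) u d.
  by move/forall_inP: cH => /(_ u uH) /forall_inP /(_ d dH).
have cl : closed (adj H) (mem U).
  apply: intro_closed; first exact: (sym_connect_sym (adj_sym H)).
  move=> x y /HG /andP[xy yDW] xU; apply: contraT => yU.
  by case/wsum_gt0P: (none x xU); exists y; rewrite // in_setD yU.
move=> /(_ cl) /=; rewrite uU => /esym dU.
by have := disjointFr dDW dD; rewrite (subsetP UW).
Qed.

Lemma cut_vertex_coloring k : verts G = setT -> cut_vertex G k ->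
  exists chi : V -> bool,
    (forall x y, x != k -> y != k -> 0 < wt G x y -> chi x = chi y) /\
    exists x y, [/\ x != k, y != k & chi x != chi y].
Proof.
move=> vG [_]; rewrite negb_forall_in => /exists_inP[x xk].
rewrite negb_forall_in => /exists_inP[y yk nxy].
rewrite /= vG setTI !inE in xk yk.
set H := induced _ _ in nxy; exists (connect (adj H) x); split; last first.
  by exists x, y; rewrite connect0 (negPf nxy).
move=> u v uk vk uv; have uvH : adj H u v by rewrite /adj /= /induced_wt !inE uk vk.
exact: (same_connect_r (sym_connect_sym (adj_sym H)) (connect1 uvH)).
Qed.

End Connectivity.

(** * The two blocks *)

Section TwoBlocks.
Variables (V : finType) (G : wgraph V) (r : V) (A B : {set V}).

Local Notation wt := (wt G).
Local Notation wsum := (wsum G).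
Local Notation burn := (burn G).

Hypotheses (vG : verts G = setT) (rA : r \notin A) (dAB : [disjoint r |: A & B]).
Hypothesis full : r |: A :|: B = setT.
Hypotheses (cAB : conn G [set r] (A :|: B)) (cA : conn G [set r] A).
Hypotheses (invA : swap_inv G A [set r] (A :|: B)).
Hypotheses (invB : swap_inv G B [set r] (A :|: B)).

Lemma two_blocks_conn : conn G (r |: A) B.
Proof. by apply: conn_sub cAB; rewrite ?subsetUr // setUA. Qed.

Lemma two_blocks_disjoint : [disjoint [set r] & A].
Proof. by rewrite disjoints1. Qed.

(** [B] can burn after everything else, so it can be deleted. *)
Lemma two_blocks_invariantA : invariant_at G [set r] A.
Proof.
split; [exact: two_blocks_disjoint | exact: cA |].
have [h bh] := conn_burn dAB two_blocks_conn.
rewrite -[[set r]]setU0; apply: (swap_inv_slice (X := B) (f := fun=> 0) (h := h)) => //.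
- by rewrite set0U.
- exact: burn0.
- by rewrite -setI_eq0 set0I.
- by rewrite setU0.
Qed.

(** [A] can burn before everything else, so it can be contracted to the root. *)
Lemma two_blocks_invariantB : invariant_at G (r |: A) B.
Proof.
split; [exact: dAB | exact: two_blocks_conn |].
have [f bf] := conn_burn two_blocks_disjoint cA.
apply: (swap_inv_slice (X := set0) (f := f) (h := fun=> 0)) => //.
- by rewrite setU0.
- by apply: disjointWl dAB; apply: subsetUr.
- exact: burn0.
Qed.

Lemma burn_value g D W u : burn g D W -> u \in W -> exists T, g u = wsum u T.
Proof.
elim=> {D W} [D|x D W xW xD x0 gx bW IH]; first by rewrite inE.
by have [->|ux uW] := eqVneq u x; [exists D | apply: IH; rewrite !inE ux].
Qed.

(** When the graph with [r |: A] contracted is a tree, such a vertex in [B] is the only obstruction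
    to an attached forest. *)
Definition spread v := exists y z,
  [/\ y \in r |: A, z \in r |: A, y != z, 0 < wt v y & 0 < wt v z].

Lemma spreadPn v : ~ spread v ->
  {in r |: A &, forall y z, 0 < wt v y -> 0 < wt v z -> y = z}.
Proof.
move=> nv y z yA zA vy vz; apply/eqP; apply: contraT => yz.
by case: nv; exists y, z.
Qed.

Lemma spreadP v : spread v \/ ~ spread v.
Proof.
have [/exists_inP[y yA /exists_inP[z zA /and3P[yz vy vz]]]|nv] :=
  boolP [exists y in r |: A, exists z in r |: A, [&& y != z, 0 < wt v y & 0 < wt v z]].
  by left; exists y, z.
right=> -[y [z [yA zA yz vy vz]]]; case/negP: nv.
by apply/exists_inP; exists y => //; apply/exists_inP; exists z => //; rewrite yz vy.
Qed.

Lemma not_spread_weight c v : tree_like G c (r |: A) B -> v \in B -> ~ spread v ->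
  {in r |: A, forall y, zero_or c (wt v y)}.
Proof.
move=> [aD _ _] vB nv y yA; have [->//|vy] := posnP (wt v y).
have := aD v vB; rewrite (wsumD1 _ _ yA) (eqP (_ : wsum v ((r |: A) :\ y) == 0)) ?addn0 //.
apply/wsum_eq0P=> z /setD1P[zy zA]; apply/eqP; rewrite -leqn0 leqNgt.
by apply: contra zy => vz; rewrite (spreadPn nv zA yA vz vy).
Qed.

(* If v burns as soon as one of its neighbours in A does, its value is not a
   multiple of c, whereas all values of an unspread vertex are. *)
Lemma spread_all c v : 0 < c -> tree_like G c (r |: A) B -> v \in B -> spread v ->
  {in B, forall u, spread u}.
Proof.
move=> c0 tB vB [y [z [yA zA yz vy vz]]] u uB.
have [//|nu] := spreadP u; exfalso; have [aD aW _] := tB.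
have [f bf] := conn_burn two_blocks_disjoint cA.
pose Z := [set t in r |: A | 0 < wt v t].
have yZ : y \in Z by rewrite inE yA. have zZ : z \in Z by rewrite inE zA.
(* The fire stops at the first neighbour [i] of [v]; letting [v] burn next gives it the value
   [wt v i]. *)
have [||i [I [IA bI ZI]]] := burn_first_hit bf (Z := Z).
- by apply/pred0Pn; exists y; rewrite /= yZ.
- by rewrite (leq_trans (subset_leq_card (subsetIr _ _))) // cards1.
have /setIP[iZ irI] : i \in Z :&: ([set r] :|: I) by rewrite ZI set11.
have [iA vi] : i \in r |: A /\ 0 < wt v i by move: iZ; rewrite inE => /andP[].
have vI : wsum v ([set r] :|: I) = wt v i.
  rewrite (wsumD1 _ _ irI) (eqP (_ : wsum v (([set r] :|: I) :\ i) == 0)) ?addn0 //.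
  apply/wsum_eq0P=> t /setD1P[ti tI]; apply/eqP; rewrite -leqn0 leqNgt.
  apply: contra ti => vt; rewrite -in_set1 -ZI inE tI andbT inE vt andbT.
  by move: tI; rewrite !inE => /orP[->//|/(subsetP IA)->]; rewrite orbT.
(* The total weight from [v] to [r |: A] is [c], and a second neighbour takes a positive share of
   it. *)
have ic : wt v i < c.
  have [j [jA ji vj]] : exists j, [/\ j \in r |: A, j != i & 0 < wt v j].
    by have [e|yi] := eqVneq y i; [exists z; rewrite -e eq_sym | exists y].
  have jAi : j \in (r |: A) :\ i by rewrite in_setD1 ji.
  have := aD v vB; rewrite /zero_or (wsumD1 _ _ iA).
  have := wsum_ge G v jAi; move: (wsum v _) => w vw.
  case/orP=> [|/eqP <-]; first by rewrite addn_eq0 -leqn0 leqNgt vi.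
  by rewrite -[ltnLHS]addn0 ltn_add2l (leq_trans vj vw).
have vA : v \notin r |: A by rewrite (disjointFl dAB).
have vrI : v \notin [set r] :|: I.
  by apply: contra vA; apply: subsetP; apply: setUS.
pose f' x := if x == v then wt v i else f x.
have bIv : burn f' [set r] (I :|: [set v]).
  apply: burn_cat; last by apply: burn1; rewrite ?vI // /f' eqxx.
  apply: burn_ext bI => x xI; rewrite /f' ifN //.
  by apply: contraNneq vrI => <-; rewrite inE xI orbT.
have IvAB : I :|: [set v] \subset A :|: B.
  by rewrite subUset sub1set inE vB orbT (subset_trans IA) ?subsetUl.
have E : (I :|: [set v]) :|: ((A :|: B) :\: (I :|: [set v])) = A :|: B.
  by rewrite -{2}(setID (A :|: B) (I :|: [set v])) (setIidPr IvAB).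
have [||g bg gf] := burn_extend (W := (A :|: B) :\: (I :|: [set v])) bIv.
- rewrite -setI_eq0 setIUl setU_eq0 !setI_eq0 disjoint_setDr andbT disjoints1.
  by rewrite !inE !negb_and !negb_or rA (disjointFr dAB) ?setU11 ?andbF ?orbT.
- by apply: conn_sub cAB; rewrite ?subsetDl // -setUA E.
rewrite E in bg; have {}bg := invB uB vB bg.
have [|T] := burn_value bg (u := u); first by rewrite inE uB orbT.
rewrite tpermL gf ?inE ?eqxx ?orbT // /f' eqxx => viT.
(* All weights at the unspread vertex [u] are 0 or [c], so its value is a multiple of [c] whatever
   has burnt before it. *)
have : c %| wt v i.
  rewrite viT; apply: dvdn_sum => t _.
  suff : zero_or c (wt u t) by case/orP=> /eqP->.
  have := in_setT t; rewrite -full => /setUP[tA|tB']; last exact: aW.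
  exact: not_spread_weight tB uB nu _ tA.
by move/dvdn_leq => /(_ vi); rewrite leqNgt ic.
Qed.

(** If [G_A] is a cycle or complete, it stays connected without [k], so [r |: A] apart from [k] lies
    on the side of [C]. If it is a tree, [tree_no_cut] applies to the colouring that is true on the
    side of [C]. *)
Lemma no_cut_outside k (chi : V -> bool) (C : {set V}) a t i1 i2 q :
  0 < a -> classified G a [set r] A ->
  k \in r |: A -> (forall x y, x != k -> y != k -> 0 < wt x y -> chi x = chi y) ->
  C \subset B -> edge_connected G C -> {in C, forall x, chi x = t} ->
  i1 \in r |: A -> i2 \in r |: A -> i1 != i2 -> 0 < wsum i1 C -> 0 < wsum i2 C ->
  q \in r |: A -> q != k -> chi q != t -> False.
Proof.
move=> a0 cl kA cut CB Cc Ct i1A i2A i12 i1C i2C qA qk qt.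
have [i [iA ik iC]] : exists i, [/\ i \in r |: A, i != k & 0 < wsum i C].
  by have [e|] := eqVneq i1 k; [exists i2; rewrite -e eq_sym | exists i1].
have it : chi i = t.
  have [y yC iy] := wsum_gt0P _ _ _ iC; rewrite -(Ct y yC); apply: cut iy => //.
  by apply: contraTneq kA => <-; rewrite (disjointFl dAB) // (subsetP CB).
have [tA|ring] : tree_like G a [set r] A \/
    (cycle_like G a [set r] A \/ exists b, complete_like G a b [set r] A).
  by case: cl; [left | right; left | right; right].
  apply: (tree_no_cut (q := q) (chi := fun x => chi x == t) a0 tA invA dAB
    two_blocks_conn CB Cc i1A i2A i12 i1C i2C kA) => // [x y xk yk xy|x /Ct->//].
  by rewrite (cut x y).
suff e : chi q = chi i by rewrite e it eqxx in qt.
case/setU1P: (kA) => [kr|kA'].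
  have inA x : x \in r |: A -> x != k -> x \in A.
    by rewrite kr !inE => /orP[->|].
  have ne x : x \in A -> x != k by move=> xA; rewrite kr; apply: contraNneq rA => <-.
  by apply: (ring_like_mono a0 ring) => [x y xA yA||]; rewrite ?inA //; apply: cut; apply: ne.
have rk : r != k by apply: contraNneq rA => ->.
have same x : x \in A :\ k -> chi x = chi r.
  move: x; apply: (ring_like_mono_del (t := chi r) a0 ring kA').
    by move=> x y /setD1P[xk _] /setD1P[yk _]; apply: cut.
  by move=> x /setD1P[xk _]; rewrite wsum1; apply: cut.
have toroot x : x \in r |: A -> x != k -> chi x = chi r.
  by case/setU1P=> [->//|xA] xk; apply: same; rewrite in_setD1 xk.
by rewrite !toroot.
Qed.

(** The two alternatives are the ways in which [B], attached to several vertices, fails to be a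
    forest. *)
Lemma no_cut_vertex a c k : 0 < a -> 0 < c -> classified G a [set r] A ->
  B != set0 ->
  {in B, forall u, spread u} \/
  (1 < #|[set i in r |: A | 0 < wsum i B]| /\
   (cycle_like G c (r |: A) B \/ exists d, complete_like G c d (r |: A) B)) ->
  ~ cut_vertex G k.
Proof.
move=> a0 c0 clA /set0Pn[v vB] shape /(cut_vertex_coloring vG).
move=> [chi [cut [x [y [xk yk xy]]]]].
have fullP z : z \in r |: A \/ z \in B.
  by apply/orP; rewrite -in_setU full.
(* If [k] lies in [B], then [r |: A] stays connected and every other vertex of [B] remains joined to
   it, either directly or along the ring. *)
have [kA|kA] := boolP (k \in r |: A); last first.
  have [f bf] := conn_burn two_blocks_disjoint cA.
  have sameA : {in r |: A, forall z, chi z = chi r}.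
    by apply: (burn_same_side bf kA cut) => z /set1P->.
  have kB : k \in B by case: (fullP k) => //; rewrite (negPf kA).
  have nA z : z \in r |: A -> z != k by apply: contraTneq => ->.
  have same z : z != k -> chi z = chi r.
    move=> zk; case: (fullP z) => [/sameA//|zB].
    case: shape => [/(_ z zB)[i [_ [iA _ _ zi _]]]|[_ ring]].
      by rewrite -(sameA i) //; apply: cut zi => //; apply: nA.
    have zBk : z \in B :\ k by rewrite in_setD1 zk.
    move: z zBk {zB zk}; apply: (ring_like_mono_del (t := chi r) c0 ring kB).
      by move=> z w /setD1P[zk _] /setD1P[wk _]; apply: cut.
    move=> z /setD1P[zk _] /wsum_gt0P[i iA zi].
    by rewrite -(sameA i) //; apply: cut zi => //; apply: nA.
  by rewrite !same ?eqxx in xy.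
have kB z : z \in B -> z != k.
  by apply: contraTneq => ->; rewrite (disjointFr dAB).
have [w wk wt] : exists2 w, w != k & chi w != chi v.
  have [e|] := eqVneq (chi x) (chi v); last by exists x.
  by exists y; rewrite // -e eq_sym.
case: shape => [sp|[S1 ring]].
  (* Here [C] is the single vertex [v]. If the vertex [w] across the cut lies in [B], one of its two
     neighbours in [r |: A] differs from [k] and replaces it. *)
  have [i1 [i2 [i1A i2A i12 v1 v2]]] := sp v vB.
  have [q qA [qk qt]] : exists2 q, q \in r |: A & q != k /\ chi q != chi v.
    case: (fullP w) => [|wB]; first by exists w.
    have [j1 [j2 [j1A j2A j12 w1 w2]]] := sp w wB.
    have [j jA [jk wj]] : exists2 j, j \in r |: A & j != k /\ 0 < wsum w [set j].
      have [e|?] := eqVneq j1 k; last by exists j1; rewrite ?wsum1.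
      by exists j2; rewrite // wsum1 -e eq_sym.
    by exists j; rewrite // -(cut w j) // -wsum1.
  apply: (no_cut_outside (C := [set v]) a0 clA kA cut _ _ _ i1A i2A i12 _ _ qA qk qt).
  - by rewrite sub1set.
  - by move=> chi' _ z z' /set1P-> /set1P->.
  - by move=> z /set1P->.
  - by rewrite wsum1 wt_sym.
  - by rewrite wsum1 wt_sym.
(* Here [C] is all of [B], which is connected without the root and avoids [k]; hence [w] lies in
   [r |: A]. *)
have /card_gt1P[i1 [i2 [i1S i2S i12]]] := S1.
have Bc : edge_connected G B by move=> chi'; apply: ring_like_mono c0 ring.
have Bt : {in B, forall z, chi z = chi v}.
  move=> z zB; apply: Bc vB => // z1 z2 z1B z2B; apply: cut; exact: kB.
have wA : w \in r |: A by case: (fullP w) => // /Bt e; rewrite e eqxx in wt.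
have /setIdP[i1A i1B] := i1S; have /setIdP[i2A i2B] := i2S.
exact: (no_cut_outside a0 clA kA cut (subxx B) Bc Bt i1A i2A i12 i1B i2B wA wk wt).
Qed.

Local Notation attachments := [set i in r |: A | 0 < wsum i B].

(** With one attachment [i], contracting [r |: A] amounts to keeping only [i]. With several, the cut
    vertex rules out the ring shapes and the spread vertices, which leaves a forest. *)
Theorem two_blocks_classified : A != set0 -> B != set0 -> (exists k, cut_vertex G k) ->
  exists2 a, 0 < a & exists2 c, 0 < c & classified G a [set r] A /\
    ((exists2 i, attachments = [set i] & classified G c (r |: A) B) \/
     (1 < #|attachments| /\ attached_forest c attachments B G)).
Proof.
move=> A0 B0 [k cutk].
have [a a0 clA] := invariant_classified two_blocks_invariantA A0.
have [c c0 clB] := invariant_classified two_blocks_invariantB B0.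
exists a => //; exists c => //; split=> //.
have [S1|S1] := ltnP 1 #|attachments|; last first.
  have /card_gt0P[i iS] : 0 < #|attachments|.
    have [x xB /wsum_gt0P[i iA xi]] := conn_next dAB two_blocks_conn B0.
    by apply/card_gt0P; exists i; rewrite inE iA; apply/wsum_gt0P; exists x; rewrite // wt_sym.
  left; exists i => //; apply/esym/eqP; rewrite eqEcard sub1set iS cards1.
  exact: S1.
right; split=> //.
have nring : ~ (cycle_like G c (r |: A) B \/ exists d, complete_like G c d (r |: A) B).
  by move=> ring; apply: (no_cut_vertex a0 c0 clA B0 _ cutk); right.
have tB : tree_like G c (r |: A) B.
  by case: clB => // cl; case: nring; [left | right].
have nsp v : v \in B -> ~ spread v.
  move=> vB sp; apply: (no_cut_vertex a0 c0 clA B0 _ cutk); left.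
  exact: spread_all c0 tB vB sp.
apply: (forest_attached (A := r |: A)) => //.
- by apply/subsetP=> i; rewrite inE => /andP[].
- move=> x y xB yA; rewrite inE yA /= -eqn0Ngt => /wsum_eq0P /(_ x xB).
  by rewrite wt_sym.
- by move=> x xB; apply: not_spread_weight tB xB (nsp x xB).
Qed.

End TwoBlocks.

(** * The standard vertex sets and the final theorem *)

Lemma card_partA p q : #|partA p q| = p.
Proof.
have inj : injective (fun i : 'I_p => inord i.+1 : 'I_(p + q).+1).
  move=> i j /(congr1 val); rewrite /= !inordK ?ltnS ?(leq_trans (ltn_ord _)) ?leq_addr //.
  by case=> /val_inj.
rewrite -[RHS]card_ord -cardsT -(card_imset _ inj); apply: eq_card => x.
rewrite !inE; apply/idP/imsetP => [/andP[x0 xp]|[i _ ->]].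
  have xp' : x.-1 < p by lia.
  by exists (Ordinal xp') => //; apply: val_inj; rewrite /= prednK // inordK.
by rewrite inordK ?ltnS ?(leq_trans (ltn_ord _)) ?leq_addr.
Qed.

Lemma rootA_partB_full p q : rootA p q :|: partB p q = setT.
Proof. by apply/setP=> x; rewrite !inE -val_eqE /=; lia. Qed.

Lemma rootA_partB_disjoint p q : [disjoint rootA p q & partB p q].
Proof.
by rewrite -setI_eq0; apply/eqP/setP=> x; rewrite !inE -val_eqE /=; lia.
Qed.

Lemma ord0_partA p q : ord0 \notin partA p q.
Proof. by rewrite inE. Qed.

Lemma card_partB p q : #|partB p q| = q.
Proof.
have := cardsUI (rootA p q) (partB p q).
rewrite rootA_partB_full (disjoint_setI0 (rootA_partB_disjoint p q)) cards0.
by rewrite cardsT card_ord cardsU1 ord0_partA card_partA addn0 add1n addSn => -[/addnI].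
Qed.

Theorem theorem6p16 (p q : nat) (G : wgraph 'I_(p + q).+1) :
  type_I G ->
  (exists v, cut_vertex G v) ->
  exists a b c d : nat,
    [/\ [/\ 0 < a, 0 < b, 0 < c & 0 < d],
        (let GA := induced G (rootA p q) in
         [\/ x_tree a GA, x_cycle a GA | complete_xy p a b ord0 GA])
      & (exists i : 'I_(p + q).+1,
           [/\ i \in rootA p q,
               (let GB := induced G (i |: partB p q) in
                [\/ x_tree c GB, x_cycle c GB | complete_xy q c d i GB])
             & forall j k, j \in rootA p q -> j != i -> k \in partB p q ->
                 ~~ adj G j k])
        \/
        (exists S : {set 'I_(p + q).+1},
           [/\ S \subset rootA p q, 1 < #|S|,
               attached_forest c S (partB p q) G
             & forall j k, j \in rootA p q -> j \notin S -> k \in partB p q ->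
                 ~~ adj G j k])].
Proof.
move=> [[p0 q0] vG cG cGA pinv] cut.
set A := partA p q; set B := partB p q.
have rA : ord0 \notin A := ord0_partA p q.
have full : ord0 |: A :|: B = setT := rootA_partB_full p q.
have dAB : [disjoint ord0 |: A & B] := rootA_partB_disjoint p q.
have ABE : A :|: B = ~: [set ord0].
  apply/setP=> x; have := in_setT x; rewrite -full in_setC in_set1 -setUA in_setU1.
  have [->|_] /= := eqVneq x ord0; last by move->.
  by rewrite inE (negPf rA) (disjointFr dAB) ?setU11.
(* A transposition inside one block is a product [s * t] with one factor trivial. *)
have sinv (P : {set 'I_(p + q).+1}) : P \subset A :|: B ->
    (forall u v, u \in P -> v \in P ->
     exists s t, [/\ perm_on A s, perm_on B t & tperm u v = (s * t)%g]) ->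
    swap_inv G P [set ord0] (A :|: B).
  move=> PAB Pst; rewrite ABE; apply: parking_swap_inv => // [|u v b uP vP pb].
    by rewrite -ABE.
  by have [s [t [sA tB ->]]] := Pst u v uP vP; apply: pinv.
have on (P : {set 'I_(p + q).+1}) u v : u \in P -> v \in P -> perm_on P (tperm u v).
  move=> uP vP; apply: subset_trans (tperm_on u v) _.
  by rewrite subUset !sub1set uP vP.
have invA : swap_inv G A [set ord0] (A :|: B).
  apply: sinv => [|u v uA vA]; first exact: subsetUl.
  by exists (tperm u v), 1%g; rewrite mulg1 perm_on1; split=> //; apply: on.
have invB : swap_inv G B [set ord0] (A :|: B).
  apply: sinv => [|u v uA vA]; first exact: subsetUr.
  by exists 1%g, (tperm u v); rewrite mul1g perm_on1; split=> //; apply: on.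
have d0A : [disjoint [set ord0] & A] by rewrite disjoints1.
have cAB : conn G [set ord0] (A :|: B).
  apply: (connected_conn cG); rewrite ?setUA ?full ?vG //.
  - by apply/set0Pn; exists ord0; rewrite set11.
  - by rewrite ABE disjoints1 !inE eqxx.
  - by move=> x y xy; rewrite inE andbT.
have cA : conn G [set ord0] A.
  apply: (connected_conn cGA); rewrite //= ?vG ?setTI //.
    by apply/set0Pn; exists ord0; rewrite set11.
  move=> x y; rewrite /adj /= /induced_wt; case: ifP => // /andP[_ yA] ->.
  exact: yA.
have A0 : A != set0 by rewrite -card_gt0 card_partA.
have B0 : B != set0 by rewrite -card_gt0 card_partB.
have [a a0 [c c0 [clA clB]]] :=
  two_blocks_classified vG rA dAB full cAB cA invA invB A0 B0 cut.
have [b b0 GA] : exists2 b, 0 < b & [\/ x_tree a (induced G (ord0 |: A)),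
    x_cycle a (induced G (ord0 |: A)) | complete_xy #|A| a b ord0 (induced G (ord0 |: A))].
  apply: (single_classified (D := [set ord0])) => //; first exact: set11.
  by move=> x y xA /set1P->; rewrite eqxx.
rewrite card_partA in GA.
have noedge (S : {set 'I_(p + q).+1}) j k : [set i in ord0 |: A | 0 < wsum G i B] = S ->
    j \in ord0 |: A -> j \notin S -> k \in B -> wt G j k = 0.
  move=> <- jA; rewrite inE jA /= -eqn0Ngt => /wsum_eq0P; exact.
case: clB => [[i SE clB]|[S1 fS]].
  have iA : i \in ord0 |: A by have := set11 i; rewrite -SE inE => /andP[].
  have none j k : j \in ord0 |: A -> j != i -> k \in B -> wt G j k = 0.
    by move=> jA ji; apply: noedge SE jA _; rewrite inE.
  have [||d d0 GB] := single_classified vG iA dAB _ c0 _ clB.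
  - by move=> x y xB yA yi; rewrite wt_sym none.
  - exact: two_blocks_conn cAB.
  rewrite card_partB in GB; exists a, b, c, d; split=> //; left; exists i; split=> //.
  by move=> j k jA ji kB; rewrite /adj none.
(* The forest case does not constrain [d]; 1 is an arbitrary positive value. *)
exists a, b, c, 1; split=> //; right; exists [set i in ord0 |: A | 0 < wsum G i B].
split=> //; first by apply/subsetP=> i; rewrite inE => /andP[].
by move=> j k jA jS kB; rewrite /adj (noedge _ _ _ (erefl _)).
Qed.
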